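(* Let $p$ be a prime and let $G$ be a finite $p$-group with $d(G)=3$, $\Phi(G)\le Z(G)$, $G'\cong C_p^3$ and $G/G'$ of type $(p^{m_1},p^{m_2},p^{m_3})$ with $m_1=m_2>m_3$, and suppose $G$ is determined by one of the characteristic matrices (G1)–(G9), (H1)–(H15), (I1)–(I6) listed in the context. (1) If $I_{\min}=m_3$, then the characteristic matrix is one of: (G1)–(G9), (H1)–(H7), (H12)–(H13). (2) If $I_{\min}=m_3+1$, then the characteristic matrix is one of: (H8)–(H11), (H14)–(H15), (I2)–(I3), (I6). (3) If $I_{\min}=m_3+2$, then the characteristic matrix is one of: (I1), (I4)–(I5). (4) If $I_{\max}=m_1+2$, then the characteristic matrix is one of: (H1)–(H2), (H3) with $-\nu\in(F_p^* )^2$, (H4) with $-r\in(F_p^* )^2$, (H5)–(H6), (H10), (H13), (H15), (I2)–(I6). (5) If $I_{\max}=m_1+1$, then the characteristic matrix is one of: (G1)–(G2), (G3) with $-\nu\in(F_p^* )^2$, (G4) with $-r\in(F_p^* )^2$, (G5)–(G6), (G8)–(G9), (H3) with $-\nu\notin(F_p^* )^2$, (H4) with $-r\notin(F_p^* )^2$, (H7)–(H9), (H11)–(H12), (H14), (I1). (6) If $I_{\max}=m_1$, then the characteristic matrix is one of: (G3) with $-\nu\notin(F_p^* )^2$, (G4) with $-r\notin(F_p^* )^2$, (G7).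
   Context: $d(G)$ is the minimal number of generators, $\Phi(G)$ the Frattini subgroup, $G'$ the derived subgroup, $C_p^3$ elementary abelian of order $p^3$, $F_p$ the field with $p$ elements, $F_p^*$ its multiplicative group and $(F_p^* )^2=\{a^2:a\in F_p^*\}$. An $\mathcal{A}_1$-group is a minimal non-abelian group (non-abelian with all proper subgroups abelian). $p^{I_{\min}}$ and $p^{I_{\max}}$ denote respectively the minimal and the maximal index in $G$ of $\mathcal{A}_1$-subgroups of $G$. Characteristic matrix: let $G/G'$ have type $(p^{m_1},p^{m_2},p^{m_3})$, $m_1\ge m_2\ge m_3\ge1$ (i.e. $G/G'\cong C_{p^{m_1}}\times C_{p^{m_2}}\times C_{p^{m_3}}$). Choose $a_1,a_2,a_3\in G$ with $G/G'=\langle a_1G'\rangle\times\langle a_2G'\rangle\times\langle a_3G'\rangle$, $o(a_iG')=p^{m_i}$; put $x=[a_2,a_3]$, $y=[a_3,a_1]$, $z=[a_1,a_2]$, so $G'=\langle x,y,z\rangle$, and write $a_i^{p^{m_i}}=x^{w_{i1}}y^{w_{i2}}z^{w_{i3}}$. The matrix $w(G)=(w_{ij})$ over $F_p$ is called a characteristic matrix of $G$; together with $p,m_1,m_2,m_3$ it determines $G$ up to isomorphism. Let $e_{ij}$ be the $3\times3$ matrix over $F_p$ with $1$ at $(i,j)$ and $0$ elsewhere; $\eta$ a fixed square non-residue modulo odd $p$; $\nu\in\{1,\eta\}$ (equal to $1$ if $p=2$); $t\in F_p$, $t\neq0$; $r\in\{1,\dots,p-2\}$. The list is: For odd $p$: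 (G1) $-e_{12}+e_{21}+e_{33}$; (G2) $\nu e_{11}-e_{12}+e_{21}+e_{33}$; (G3) $e_{11}+\nu e_{22}+e_{33}$; (G4) $e_{11}-e_{12}+e_{21}+re_{22}+e_{33}$; (H1) $-e_{12}+e_{21}$; (H2) $e_{11}-e_{12}+e_{21}$; (H3) $e_{11}+\nu e_{22}$; (H4) $e_{11}-e_{12}+e_{21}+re_{22}$. For $p=2$: (G5) $e_{12}+e_{21}+e_{33}$; (G6) $e_{11}+e_{22}+e_{33}$; (G7) $e_{11}+e_{12}+e_{22}+e_{33}$; (H5) $e_{12}+e_{21}$; (H6) $e_{11}+e_{22}$; (H7) $e_{11}+e_{12}+e_{22}$. For all $p$: (G8) $e_{11}+e_{23}+te_{32}$; (G9) $e_{12}+e_{23}+e_{31}$; (H8) $e_{21}+e_{33}$; (H9) $\nu e_{22}+e_{33}$; (H10) $e_{21}+e_{32}$; (H11) $e_{22}+e_{31}$; (H12) $e_{11}+e_{23}$; (H13) $e_{12}+e_{23}$; (H14) $e_{23}+e_{31}$; (H15) $e_{23}+te_{32}$; (I1) $e_{33}$; (I2) $e_{21}$; (I3) $e_{22}$; (I4) $e_{31}$; (I5) $0$; (I6) $e_{23}$. *)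

(* Defs.v *)
From mathcomp Require Export all_boot all_order all_algebra.
From mathcomp Require Export all_fingroup all_solvable.

Set Implicit Arguments.
Unset Strict Implicit.
Unset Printing Implicit Defensive.

Import GRing.Theory.

(* Minimal non-abelian groups. *)
Definition A1_group (gT : finGroupType) (H : {group gT}) : bool :=
  ~~ abelian H && [forall K : {group gT}, (K \proper H) ==> abelian K].

Definition A1_subgroup (gT : finGroupType) (G H : {group gT}) : bool :=
  (H \subset G) && A1_group H.

(* I_min = k, resp. I_max = k: the least, resp. greatest, index in G of an
   A_1-subgroup is p ^ k. *)
Definition is_Imin (gT : finGroupType) (p : nat) (G : {group gT}) (k : nat) :=
  (exists2 H : {group gT}, A1_subgroup G H & #|G : H|%g = p ^ k) /\
  (forall H : {group gT}, A1_subgroup G H -> p ^ k <= #|G : H|%g).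

Definition is_Imax (gT : finGroupType) (p : nat) (G : {group gT}) (k : nat) :=
  (exists2 H : {group gT}, A1_subgroup G H & #|G : H|%g = p ^ k) /\
  (forall H : {group gT}, A1_subgroup G H -> #|G : H|%g <= p ^ k).

(* W is a characteristic matrix of G for some choice of a1, a2, a3; the indices
   1, 2, 3 are the ordinals 0, 1, 2 of 'I_3, and an entry of 'F_p is used as an
   exponent through its representative in {0, ..., p - 1}. *)
Definition char_matrix (gT : finGroupType) (p m1 m2 m3 : nat)
    (G : {group gT}) (W : 'M['F_p]_3) : Prop :=
  let G' := (G^`(1))%G in
  exists a1 a2 a3 : gT,
  [/\ [/\ a1 \in G, a2 \in G & a3 \in G],
      (<[coset G' a1]> \x <[coset G' a2]> \x <[coset G' a3]> = G / G')%g,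
      [/\ #[coset G' a1]%g = p ^ m1,
          #[coset G' a2]%g = p ^ m2 &
          #[coset G' a3]%g = p ^ m3]
    & let x := [~ a2, a3]%g in
      let y := [~ a3, a1]%g in
      let z := [~ a1, a2]%g in
      let i1 := inord 0 : 'I_3 in
      let i2 := inord 1 : 'I_3 in
      let i3 := inord 2 : 'I_3 in
      [/\ (a1 ^+ (p ^ m1)%N = x ^+ W i1 i1 * y ^+ W i1 i2 * z ^+ W i1 i3)%g,
          (a2 ^+ (p ^ m2)%N = x ^+ W i2 i1 * y ^+ W i2 i2 * z ^+ W i2 i3)%g &
          (a3 ^+ (p ^ m3)%N = x ^+ W i3 i1 * y ^+ W i3 i2 * z ^+ W i3 i3)%g]].

Definition nonzero_square (p : nat) (c : 'F_p) : bool :=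
  [exists a : 'F_p, (a != 0%R) && (c == a ^+ 2)%R].

(* Unlike the ordinals, i and j range over 1, 2, 3. *)
Definition e_ (p : nat) (i j : nat) : 'M['F_p]_3 :=
  delta_mx (inord i.-1) (inord j.-1).

(* The argument of G2, G3, H3, H9 is nu, that of G4, H4 is r, and that of
   G8, H15 is t. *)
Inductive label (p : nat) : Type :=
| G1 | G2 of 'F_p | G3 of 'F_p | G4 of nat
| G5 | G6 | G7 | G8 of 'F_p | G9
| H1 | H2 | H3 of 'F_p | H4 of nat
| H5 | H6 | H7 | H8 | H9 of 'F_p | H10 | H11 | H12 | H13 | H14 | H15 of 'F_p
| I1 | I2 | I3 | I4 | I5 | I6.

Definition label_mx (p : nat) (l : label p) : 'M['F_p]_3 :=
  (match l with
  | G1    => - e_ p 1 2 + e_ p 2 1 + e_ p 3 3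
  | G2 nu => nu *: e_ p 1 1 - e_ p 1 2 + e_ p 2 1 + e_ p 3 3
  | G3 nu => e_ p 1 1 + nu *: e_ p 2 2 + e_ p 3 3
  | G4 r  => e_ p 1 1 - e_ p 1 2 + e_ p 2 1 + r%:R *: e_ p 2 2 + e_ p 3 3
  | G5    => e_ p 1 2 + e_ p 2 1 + e_ p 3 3
  | G6    => e_ p 1 1 + e_ p 2 2 + e_ p 3 3
  | G7    => e_ p 1 1 + e_ p 1 2 + e_ p 2 2 + e_ p 3 3
  | G8 t  => e_ p 1 1 + e_ p 2 3 + t *: e_ p 3 2
  | G9    => e_ p 1 2 + e_ p 2 3 + e_ p 3 1
  | H1    => - e_ p 1 2 + e_ p 2 1
  | H2    => e_ p 1 1 - e_ p 1 2 + e_ p 2 1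
  | H3 nu => e_ p 1 1 + nu *: e_ p 2 2
  | H4 r  => e_ p 1 1 - e_ p 1 2 + e_ p 2 1 + r%:R *: e_ p 2 2
  | H5    => e_ p 1 2 + e_ p 2 1
  | H6    => e_ p 1 1 + e_ p 2 2
  | H7    => e_ p 1 1 + e_ p 1 2 + e_ p 2 2
  | H8    => e_ p 2 1 + e_ p 3 3
  | H9 nu => nu *: e_ p 2 2 + e_ p 3 3
  | H10   => e_ p 2 1 + e_ p 3 2
  | H11   => e_ p 2 2 + e_ p 3 1
  | H12   => e_ p 1 1 + e_ p 2 3
  | H13   => e_ p 1 2 + e_ p 2 3
  | H14   => e_ p 2 3 + e_ p 3 1
  | H15 t => e_ p 2 3 + t *: e_ p 3 2
  | I1    => e_ p 3 3
  | I2    => e_ p 2 1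
  | I3    => e_ p 2 2
  | I4    => e_ p 3 1
  | I5    => 0
  | I6    => e_ p 2 3
  end)%R.

(* The restrictions on p and on the parameters under which a label belongs to
   the list; eta is the fixed non-residue, relevant for odd p only. *)
Definition nu_ok (p : nat) (eta nu : 'F_p) : bool :=
  (nu == 1%R) || odd p && (nu == eta).

Definition admissible (p : nat) (eta : 'F_p) (l : label p) : bool :=
  match l with
  | G1 | H1 | H2 => odd p
  | G2 nu | G3 nu | H3 nu => odd p && nu_ok eta nu
  | G4 r | H4 r => odd p && (1 <= r <= p - 2)
  | G5 | G6 | G7 | H5 | H6 | H7 => p == 2
  | G8 t | H15 t => t != 0%R
  | H9 nu => nu_ok eta nu
  | G9 | H8 | H10 | H11 | H12 | H13 | H14
  | I1 | I2 | I3 | I4 | I5 | I6 => true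
  end.

(* Main.v *)
Require Import Defs.
From mathcomp Require Import mxabelem ring zify.

Set Implicit Arguments.
Unset Strict Implicit.
Unset Printing Implicit Defensive.

Import GRing.Theory.
Local Open Scope group_scope.

(** G has class 2 and its A_1-subgroups are exactly the nonabelian <g, h>. In
    the basis x, y, z the group G' is F_p^3 and the commutator is the cross
    product of the coordinates of g and h along a1, a2, a3. Write w1, w2, w3 for
    the rows of the characteristic matrix and m = m1 = m2, n = m3.

    The p^m-th powers in G span <w1, w2>, so a two-generator H has order at most
    p^(2m + 1 + rank(w1, w2)); equality holds for H = <a1 a3^c, a2 a3^d> as soon
    as [H, H] is not in <w1, w2>, and then H G' <a3> = G. Hence
    I_min = n + 2 - rank(w1, w2).

    Modulo central elements, the A_1-subgroups of large index contain a3: they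
    are generated by g = a1^al a2^be and h = a3 v with v a p-th power, and the
    index is largest when h^(p^n) lies in G'. Then H meets G' in the span of the
    normal (be, -al, 0) = [g, h], of al w1 + be w2 and of w3 + l1 w1 + l2 w2.
    Hence I_max = m + 3 - D, where D is the least rank of such a triple. For the
    labels with a parameter nu or r, D depends on whether the quadratic form
    (al w1 + be w2) . (al, be, 0) has a nontrivial zero. *)

(** * Two-generator subgroups, their orders and indices *)

Lemma nonabelian_noncommuting (gT : finGroupType) (H : {group gT}) :
  ~~ abelian H -> exists g h, [/\ g \in H, h \in H & [~ g, h] != 1].
Proof.
move=> nabH; have [g Hg ncg] : exists2 g, g \in H & ~~ (g \in 'C(H)).
  by apply/subsetPn.
have [h Hh ncgh] : exists2 h, h \in H & [~ g, h] != 1.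
  apply/exists_inP; apply: contraR ncg => /exists_inPn comm_g.
  by apply/centP=> h /comm_g; rewrite negbK => /commgP.
by exists g, h.
Qed.

(** Any noncommuting pair in [H] generates a nonabelian subgroup, which minimality forces to be all
    of [H]. *)
Lemma A1_subgroup_gen (gT : finGroupType) (G H : {group gT}) :
  A1_subgroup G H ->
  exists g h, [/\ g \in G, h \in G, [~ g, h] != 1 & H :=: <<[set g; h]>>].
Proof.
case/and3P=> sHG nabH /forallP minH.
have [g [h [Hg Hh ncgh]]] := nonabelian_noncommuting nabH.
exists g, h; rewrite !(subsetP sHG) //; split=> //.
apply/eqP; rewrite eq_sym eqEproper gen_subG subUset !sub1set Hg Hh /=.
apply: contra ncgh => prK; have := minH <<[set g; h]>>%G; rewrite prK /=.
move=> abK; apply/commgP; apply: (centsP abK); apply: mem_gen.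
  by rewrite !inE eqxx.
by rewrite !inE eqxx orbT.
Qed.

(** Modulo [K] the two generators commute, so the quotient is a product of two cyclic groups of
    orders dividing [M] and [N]. *)
Lemma card_gen2_le (gT : finGroupType) (K : {group gT}) (M N : nat) (g h : gT) :
    0 < M -> 0 < N -> g \in 'N(K) -> h \in 'N(K) -> [~ g, h] \in K ->
    g ^+ M \in K -> h ^+ N \in K ->
  #|<<[set g; h]>>| <= M * N * #|K|.
Proof.
move=> M_gt0 N_gt0 nKg nKh Kgh KgM KhN.
pose H := <<[set g; h]>>%G; rewrite -[<<[set g; h]>>]/(gval H).
have nKH : H \subset 'N(K) by rewrite gen_subG subUset !sub1set nKg.
have le_quo : #|H / K| <= M * N.
  have -> : H / K = <[coset K g]> * <[coset K h]>.
    rewrite /quotient morphim_gen ?subUset ?sub1set ?nKg //.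
    rewrite morphimU !morphim_set1 // -joingE -joing_idl -joing_idr -comm_joingE //.
    apply: centC; rewrite cent_cycle cycle_subG; apply/cent1P/commgP.
    by rewrite -morphR //; apply/eqP/coset_id.
  rewrite (leq_trans (dvdn_leq _ (dvdn_cardMg _ _))) ?muln_gt0 ?cardG_gt0 //.
  by rewrite leq_mul // -orderE dvdn_leq // order_dvdn -morphX //; apply/eqP/coset_id.
have leH : #|H| <= #|H / K| * #|K|.
  rewrite card_quotient // -{1}(LagrangeI H K) mulnC leq_mul2l.
  by rewrite subset_leq_card ?subsetIr ?orbT.
by rewrite (leq_trans leH) // leq_mul2r le_quo orbT.
Qed.

(** [H / 'Phi(H)] has order at most p^2. A proper [K] still generates a proper subgroup together
    with ['Phi(H)], so its image in this quotient is cyclic. Since ['Phi(H)] lies in ['Phi(G)],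
    hence in the centre of [G], that subgroup is abelian. *)
Lemma A1_subgroup_gen2 (gT : finGroupType) (p : nat) (G : {group gT}) (g h : gT) :
    prime p -> p.-group G -> 'Phi(G) \subset 'Z(G) ->
    g \in G -> h \in G -> [~ g, h] != 1 ->
  A1_subgroup G <<[set g; h]>>%G.
Proof.
move=> p_pr pG sPhiZ Gg Gh ncgh; pose H := <<[set g; h]>>%G.
have sHG : H \subset G by rewrite gen_subG subUset !sub1set Gg.
have [Hg Hh]: g \in H /\ h \in H by rewrite !mem_gen // !inE eqxx ?orbT.
have pH := pgroupS sHG pG; have p_gt0 := prime_gt0 p_pr.
apply/and3P; split=> //.
  by apply: contra ncgh => abH; apply/commgP/(centsP abH).
apply/forallP=> K; apply/implyP=> /andP[sKH nsHK].
have [abP expP] := abelemP p_pr (Phi_quotient_abelem pH).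
have nPH : H \subset 'N('Phi(H)) := gFnorm _ _.
have oH : #|H / 'Phi(H)| <= p ^ 2.
  have PhiX x : x \in H -> x ^+ p \in 'Phi(H).
    move=> Hx; have nPx := subsetP nPH x Hx.
    by rewrite coset_idr ?groupX // morphX // expP ?mem_quotient.
  have : #|H| <= p * p * #|'Phi(H)|.
    apply: card_gen2_le; rewrite ?PhiX ?(subsetP nPH) //.
    rewrite coset_idr ?groupR ?(subsetP nPH) // morphR ?(subsetP nPH) //.
    by apply/eqP/commgP/(centsP abP); rewrite mem_quotient.
  rewrite mulnn -(Lagrange (Phi_sub H)) mulnC leq_pmul2r //.
  by rewrite card_quotient.
have sPZ : 'Phi(H) \subset 'Z(G) := subset_trans (PhiS pG sHG) sPhiZ.
apply: (@abelianS _ _ (K <*> 'Phi(H))%G); first exact: joing_subl.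
have sKPH : K <*> 'Phi(H) \subset H by rewrite join_subG sKH Phi_sub.
apply: (@cyclic_factor_abelian _ 'Phi(H)%G).
  rewrite subsetI joing_subr (subset_trans sPZ) //.
  by rewrite (subset_trans (subsetIr _ _)) // centS // (subset_trans sKPH).
have pKP : p.-group ((K <*> 'Phi(H)) / 'Phi(H)).
  by rewrite quotient_pgroup // (pgroupS sKPH).
have prK : (K <*> 'Phi(H)) / 'Phi(H) \proper H / 'Phi(H).
  rewrite properE quotientS //= quotientSGK ?joing_subr //.
  apply: contra nsHK => sHKP; suff <- : <<K>> = H by rewrite genGid.
  by apply: Phi_nongen; apply/eqP; rewrite eqEsubset joingC sKPH.
have [k oK] := p_natP pKP.
case: k oK => [|[|k]] oK; last 1 first.
- have := leq_trans (proper_card prK) oH; rewrite oK ltn_exp2l ?prime_gt1 //.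
- by rewrite (card1_trivg oK) cyclic1.
- by rewrite prime_cyclic // oK.
Qed.

(** Split the index at [M = H G']: the quotient [G / M] is generated by the image of [u], and the
    index of [H] in [M] is that of [H :&: G'] in [G']. *)
Lemma index_le (gT : finGroupType) (G H : {group gT}) (K : {set gT}) (u : gT) (N : nat) :
    0 < N -> H \subset G -> u \in G -> K \subset H :&: G^`(1) ->
    G \subset H <*> G^`(1) <*> <[u]> -> u ^+ N \in H <*> G^`(1) ->
  #|G : H| * #|K| <= N * #|G^`(1)|.
Proof.
move=> N_gt0 sHG Gu sK sGHu HuN; set M := (H <*> G^`(1))%G.
have sMG : M \subset G by rewrite join_subG sHG der_sub.
have nMG : G \subset 'N(M) by rewrite sub_der1_norm ?joing_subr.
have nDH : H \subset 'N(G^`(1)) by rewrite (subset_trans sHG) ?der_norm.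
have oGM : #|G : M| <= N.
  rewrite -card_quotient //.
  have sGu : G / M \subset <[coset M u]>.
    apply: subset_trans (quotientS _ sGHu) _.
    rewrite quotientYidl ?cycle_subG ?(subsetP nMG) // quotient_cycle ?(subsetP nMG) //.
  rewrite (leq_trans (subset_leq_card sGu)) // -orderE dvdn_leq //.
  by rewrite order_dvdn -morphX ?(subsetP nMG) //; apply/eqP/coset_id.
have oHM : #|M : H| * #|K| <= #|G^`(1)|.
  have oM : (#|H| * #|M : H|)%N = #|H * G^`(1)|.
    by rewrite (Lagrange (joing_subl _ _)) /= norm_joinEl.
  rewrite -(leq_pmul2l (cardG_gt0 H)) mulnA oM (mul_cardG H).
  by rewrite leq_mul2l subset_leq_card ?orbT.
rewrite -(Lagrange_index sMG (joing_subl _ _)) -mulnA leq_mul //.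
Qed.

Lemma coprime_expg_mem (gT : finGroupType) (p d : nat) (M : {group gT}) (a : gT) :
  p.-elt a -> coprime p d -> a ^+ d \in M -> a \in M.
Proof.
move=> pa copd Mad; have coad : coprime #[a] d.
  have [e ->] := p_natP pa; exact: coprimeXl.
have /eqP gen_ad : generator <[a]> (a ^+ d) by rewrite generator_coprime.
by rewrite -cycle_subG gen_ad cycle_subG.
Qed.

(* For 1 < m this kills the commutator term of (g h)^(p^m), also when p = 2. *)
Lemma dvdn_bin2_expn (p m : nat) : prime p -> 1 < m -> (p %| 'C(p ^ m, 2))%N.
Proof.
move=> p_pr m_gt1; set q := (p ^ m)%N.
have : (p * p %| 2 * 'C(q, 2))%N.
  by rewrite -mul_bin_diag bin1 mulnn dvdn_mulr ?dvdn_exp2l.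
have [-> | p_neq2] := eqVneq p 2; first by rewrite dvdn_pmul2l.
move/(dvdn_trans (dvdn_mulr p (dvdnn p))); rewrite Gauss_dvdr //.
by rewrite prime_coprime // dvdn_prime2 //.
Qed.

(** * Rows of length three and arithmetic modulo p *)

Definition row3 (R : Type) (a b c : R) : 'rV[R]_3 := \row_j nth a [:: a; b; c] j.

Section Row3.
Variable R : nzRingType.
Implicit Types a b c : R.

Lemma row3E a b c :
  ((row3 a b c 0%R (inord 0) = a) * (row3 a b c 0%R (inord 1) = b) *
   (row3 a b c 0%R (inord 2) = c))%type.
Proof. by rewrite !mxE !inordK. Qed.

Lemma row3P (u v : 'rV[R]_3) :
  u 0%R (inord 0) = v 0%R (inord 0) -> u 0%R (inord 1) = v 0%R (inord 1) ->
  u 0%R (inord 2) = v 0%R (inord 2) -> u = v.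
Proof.
move=> e0 e1 e2; apply/rowP=> j; rewrite -(inord_val j).
by case: j => -[|[|[|]]].
Qed.

Lemma row3D a b c a' b' c' :
  (row3 a b c + row3 a' b' c' = row3 (a + a') (b + b') (c + c'))%R.
Proof. by apply: row3P; rewrite !mxE !inordK. Qed.

Lemma row3N a b c : (- row3 a b c = row3 (- a) (- b) (- c))%R.
Proof. by apply: row3P; rewrite !mxE !inordK. Qed.

Lemma row3Z d a b c : (d *: row3 a b c = row3 (d * a) (d * b) (d * c))%R.
Proof. by apply: row3P; rewrite !mxE !inordK. Qed.
End Row3.

Lemma rank_adds_row_le (F : fieldType) r k (A : 'M[F]_(r, k)) (v : 'rV_k) :
  \rank (v + A)%MS <= (\rank A).+1.
Proof.
apply: leq_trans (mxrank_adds_leqif _ _).1 _.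
by rewrite -(add1n (\rank A)) leq_add2r rank_leq_row.
Qed.

Lemma rank_adds_row (F : fieldType) r k (A : 'M[F]_(r, k)) (v : 'rV_k) :
  ~~ (v <= A)%MS -> \rank (v + A)%MS = (\rank A).+1.
Proof.
move=> nAv; apply/eqP; rewrite eqn_leq rank_adds_row_le rank_ltmx //.
by rewrite ltmxE addsmxSr addsmx_sub submx_refl andbT.
Qed.

Section PrimeField.

Variable p : nat.
Hypothesis p_pr : prime p.

Lemma Fp_nat_eq0 e : ((e%:R == 0 :> 'F_p)%R) = (p %| e).
Proof. by rewrite (dvdn_pcharf (pchar_Fp p_pr)). Qed.

Lemma Fp_coprime (d : nat) : (d%:R != 0 :> 'F_p)%R -> coprime p d.
Proof. by rewrite Fp_nat_eq0 -prime_coprime. Qed.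

(** Exponents are natural numbers, so [(p ^ q).-1] plays the part of -1 modulo [p ^ q]; this is its
    residue modulo p. *)
Lemma pred_expn_Fp q : 0 < q -> ((p ^ q).-1%:R = -1 :> 'F_p)%R.
Proof.
move=> q_gt0; apply/eqP.
rewrite -subr_eq0 opprK natr1 prednK ?expn_gt0 ?prime_gt0 //.
by rewrite Fp_nat_eq0 dvdn_exp.
Qed.

Lemma inv_mod_expn q i : coprime p i -> exists e, (e * i = 1 %[mod p ^ q])%N.
Proof.
case: (posnP i) => [-> | i_gt0 copi].
  by rewrite /coprime gcdn0 gtn_eqF ?prime_gt1.
have [e t et _] := egcdnP (p ^ q) i_gt0; exists e.
have /eqP cop : coprime i (p ^ q) by rewrite coprime_sym coprimeXl.
by rewrite et cop modnMDl.
Qed.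

End PrimeField.

Lemma mul3_commute (gT : finGroupType) (x1 x2 y1 y2 z1 z2 : gT) :
    commute y1 x2 -> commute z1 x2 -> commute z1 y2 ->
  x1 * x2 * (y1 * y2) * (z1 * z2) = x1 * y1 * z1 * (x2 * y2 * z2).
Proof.
move=> cyx czx czy; rewrite -!mulgA [z1 * (x2 * _)]mulgA czx -[x2 * z1 * _]mulgA.
rewrite [y1 * (x2 * _)]mulgA cyx -[x2 * y1 * _]mulgA.
by rewrite [z1 * (y2 * _)]mulgA czy -[y2 * z1 * _]mulgA.
Qed.

(** * The derived subgroup as a vector space over F_p *)

Section CharMatrix.

Variables (gT : finGroupType) (G : {group gT}) (p m n : nat) (a1 a2 a3 : gT).
Local Notation D := (G^`(1))%G.
Local Notation x := [~ a2, a3].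
Local Notation y := [~ a3, a1].
Local Notation z := [~ a1, a2].
Local Notation o0 := (inord 0 : 'I_3).
Local Notation o1 := (inord 1 : 'I_3).
Local Notation o2 := (inord 2 : 'I_3).

Hypotheses (p_pr : prime p) (pG : p.-group G) (sDZ : D \subset 'Z(G)).
Hypotheses (abelD : p.-abelem D) (oD : #|D| = (p ^ 3)%N).
Hypotheses (n_gt0 : 0 < n) (n_lt_m : n < m).
Hypotheses (Ga1 : a1 \in G) (Ga2 : a2 \in G) (Ga3 : a3 \in G).

(** The coordinate map from F_p^3 to [G'], shaped like the power relations in [char_matrix]; it
    becomes an isomorphism by [vecD_im] and [vecD_inj]. *)
Definition vecD (u : 'rV['F_p]_3) : gT :=
  x ^+ u 0%R o0 * y ^+ u 0%R o1 * z ^+ u 0%R o2.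

Lemma D_central c g : c \in D -> g \in G -> commute c g.
Proof. by move=> /(subsetP sDZ) /setIP[_ /centP cGc] /cGc. Qed.

Lemma D_expp c : c \in D -> c ^+ p = 1.
Proof. by case/(abelemP p_pr): abelD => _; apply. Qed.

Lemma commD g h : g \in G -> h \in G -> [~ g, h] \in D.
Proof. by move=> Gg Gh; rewrite mem_commg. Qed.

Lemma Dx : x \in D. Proof. exact: commD. Qed.

Lemma Dy : y \in D. Proof. exact: commD. Qed.

Lemma Dz : z \in D. Proof. exact: commD. Qed.

Lemma sub_DG c : c \in D -> c \in G.
Proof. exact: (subsetP (der_sub 1 G)). Qed.

Lemma commMl g h k : g \in G -> h \in G -> k \in G ->
  [~ g * h, k] = [~ g, k] * [~ h, k].
Proof.
by move=> Gg Gh Gk; rewrite commMgJ conjgE (D_central (commD Gg Gk) Gh) mulKg.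
Qed.

Lemma commXl g h i : g \in G -> h \in G -> [~ g ^+ i, h] = [~ g, h] ^+ i.
Proof. by move=> Gg Gh; rewrite commXg //; apply/commute_sym/D_central/Gg/commD. Qed.

Lemma commMr g h k : g \in G -> h \in G -> k \in G ->
  [~ g, h * k] = [~ g, h] * [~ g, k].
Proof.
move=> Gg Gh Gk; rewrite commgMJ conjgE (D_central (commD Gg Gh) Gk) mulKg.
by rewrite (D_central (commD Gg Gk)) // sub_DG ?commD.
Qed.

Lemma commXr g h i : g \in G -> h \in G -> [~ g, h ^+ i] = [~ g, h] ^+ i.
Proof. by move=> Gg Gh; rewrite commgX //; apply/commute_sym/D_central/Gh/commD. Qed.

Lemma expg_Fp c (a : nat) : c \in D -> c ^+ (a%:R : 'F_p)%R = c ^+ a.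
Proof. by move=> Dc; rewrite val_Fp_nat // expg_mod ?D_expp. Qed.

Lemma expg_FpD c (a b : 'F_p) : c \in D -> c ^+ (a + b)%R = c ^+ a * c ^+ b.
Proof.
by move=> Dc; rewrite -expgD -(expg_Fp (a + b)%N Dc) natrD !natr_Zp.
Qed.

Lemma vecD_in u : vecD u \in D.
Proof. by rewrite !groupM ?groupX ?Dx ?Dy ?Dz. Qed.

Lemma vecDD : {in setT &, {morph vecD : u v / u * v}}.
Proof.
move=> u v _ _; rewrite /vecD !mxE !expg_FpD ?Dx ?Dy ?Dz //.
by apply: mul3_commute; apply: D_central; rewrite ?sub_DG ?groupX ?Dx ?Dy ?Dz.
Qed.

Canonical vecD_morphism := Morphism vecDD.

Lemma vecD_add u v : vecD (u + v)%R = vecD u * vecD v.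
Proof. by rewrite -vecDD ?inE. Qed.

Lemma vecD_nat u (k : nat) : vecD (k%:R *: u)%R = vecD u ^+ k.
Proof.
elim: k => [|k IHk]; first by rewrite scale0r /vecD !mxE !mul1g.
by rewrite -natr1 scalerDl scale1r vecD_add IHk expgSr.
Qed.

Lemma vecD_opp u : vecD (- u)%R = (vecD u)^-1.
Proof.
apply/(mulgI (vecD u)); rewrite -vecD_add subrr mulgV.
by rewrite /vecD !mxE !mul1g.
Qed.

Lemma vecD0 : vecD 0%R = 1.
Proof. by rewrite /vecD !mxE !mul1g. Qed.

Lemma vecD_row3 (i j k : nat) :
  vecD (row3 i%:R j%:R k%:R)%R = x ^+ i * y ^+ j * z ^+ k.
Proof. by rewrite /vecD !row3E !expg_Fp ?Dx ?Dy ?Dz. Qed.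

Variables w1 w2 w3 : 'rV['F_p]_3.
Hypotheses (ew1 : a1 ^+ (p ^ m) = vecD w1) (ew2 : a2 ^+ (p ^ m) = vecD w2).
Hypothesis (ew3 : a3 ^+ (p ^ n) = vecD w3).
Hypothesis genG : G \subset <[a1]> * <[a2]> * <[a3]> * D.

(** * Coordinates modulo [G'], commutators and powers *)

Local Notation b1 := (coset D a1).
Local Notation b2 := (coset D a2).
Local Notation b3 := (coset D a3).

Lemma a1q : a1 ^+ (p ^ m) \in D. Proof. by rewrite ew1 vecD_in. Qed.

Lemma a2q : a2 ^+ (p ^ m) \in D. Proof. by rewrite ew2 vecD_in. Qed.

Lemma a3q : a3 ^+ (p ^ n) \in D. Proof. by rewrite ew3 vecD_in. Qed.

(** The exponents are arbitrary naturals, hence not unique: [coords_mod] changes them modulo [p ^ m]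
    and [p ^ n], while commutators see them only modulo p. *)
Definition coords (g : gT) (i j k : nat) :=
  (g \in G) /\ coset D g = b1 ^+ i * b2 ^+ j * b3 ^+ k.

Lemma nDG g : g \in G -> g \in 'N(D).
Proof. exact: (subsetP (der_norm 1 G)). Qed.

Lemma cosetC g h : g \in G -> h \in G -> commute (coset D g) (coset D h).
Proof.
move=> Gg Gh; have abQ : abelian (G / D) := der_abelian 0 G.
by apply: (centsP abQ); rewrite mem_quotient.
Qed.

Lemma coordsM g h i j k i' j' k' :
  coords g i j k -> coords h i' j' k' -> coords (g * h) (i + i') (j + j') (k + k').
Proof.
case=> Gg eg [Gh eh]; split; first exact: groupM.
rewrite morphM ?nDG //= eg eh !expgD mul3_commute //.
all: by apply: commuteX2; apply: cosetC.
Qed.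

Lemma coords1 c : c \in D -> coords c 0 0 0.
Proof. by move=> Dc; split; rewrite ?sub_DG // coset_id // !mulg1. Qed.

Lemma coordsX g i j k e : coords g i j k -> coords (g ^+ e) (e * i) (e * j) (e * k).
Proof.
move=> cg; elim: e => [|e IHe]; first exact: coords1 (group1 _).
by rewrite expgS !mulSn; apply: coordsM.
Qed.

Lemma coords_a1 : coords a1 1 0 0.
Proof. by split; rewrite // !mulg1. Qed.

Lemma coords_a2 : coords a2 0 1 0.
Proof. by split; rewrite // mulg1 mul1g. Qed.

Lemma coords_a3 : coords a3 0 0 1.
Proof. by split; rewrite // !mul1g. Qed.

Lemma coords_mod g i j k i' j' k' :
    i = i' %[mod p ^ m] -> j = j' %[mod p ^ m] -> k = k' %[mod p ^ n] ->
  coords g i j k -> coords g i' j' k'.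
Proof.
have bX a q : a \in G -> a ^+ q \in D -> coset D a ^+ q = 1.
  by move=> Ga Da; rewrite -morphX ?nDG //; apply: coset_id.
move=> ei ej ek [Gg eg]; split=> //; rewrite eg.
have bE a q i1 i2 : a \in G -> a ^+ q \in D -> i1 = i2 %[mod q] ->
    coset D a ^+ i1 = coset D a ^+ i2.
  move=> Ga Da e12; have b1 := bX a q Ga Da.
  by rewrite -(expg_mod i1 b1) e12 (expg_mod i2 b1).
by rewrite (bE a1 _ i i' Ga1 a1q) // (bE a2 _ j j' Ga2 a2q) // (bE a3 _ k k' Ga3 a3q).
Qed.

Lemma coordsP g i j k : coords g i j k ->
  exists2 c, c \in D & g = a1 ^+ i * a2 ^+ j * a3 ^+ k * c.
Proof.
case=> Gg eg; set r := a1 ^+ i * a2 ^+ j * a3 ^+ k.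
have Gr : r \in G by rewrite !groupM ?groupX.
have : g \in D :* r.
  apply/rcoset_kercosetP; rewrite ?nDG // eg.
  by rewrite /r !morphM ?morphX ?nDG ?groupM ?groupX.
by case/rcosetP=> c Dc ->; exists c => //; apply: D_central.
Qed.

Lemma coords_exists g : g \in G -> exists i j k, coords g i j k.
Proof.
move=> Gg; have /(subsetP genG) := Gg.
case/mulsgP=> u c /mulsgP[u' w /mulsgP[s t /cycleP[i ->] /cycleP[j ->] ->]].
case/cycleP=> k -> -> Dc ->.
exists (i + 0 + 0 + 0), (0 + j + 0 + 0), (0 + 0 + k + 0).
apply: coordsM (coords1 Dc); apply: coordsM; first apply: coordsM.
- by have := coordsX i coords_a1; rewrite !muln0 muln1.
- by have := coordsX j coords_a2; rewrite !muln0 muln1.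
- by have := coordsX k coords_a3; rewrite !muln0 muln1.
Qed.

Lemma commD1l c g : c \in D -> g \in G -> [~ c, g] = 1.
Proof. by move=> Dc Gg; apply/eqP/commgP/D_central. Qed.

(** Class 2 makes the commutator bilinear and blind to central factors; expanding along [a1], [a2],
    [a3] leaves only [x], [y], [z] and their inverses. *)
Lemma coords_comm g i j k h i' j' k' : coords g i j k -> coords h i' j' k' ->
  [~ g, h] = vecD (row3 (j%:R * k'%:R - k%:R * j'%:R) (k%:R * i'%:R - i%:R * k'%:R)
                        (i%:R * j'%:R - j%:R * i'%:R))%R.
Proof.
move=> /coordsP[c Dc ->] /coordsP[c' Dc' ->].
have comm_r a : a \in G -> [~ a, a1 ^+ i' * a2 ^+ j' * a3 ^+ k' * c'] =
    [~ a, a1] ^+ i' * [~ a, a2] ^+ j' * [~ a, a3] ^+ k'.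
  move=> Ga; rewrite !commMr ?groupM ?groupX ?(sub_DG Dc') // !commXr //.
  by rewrite (_ : [~ a, c'] = 1) ?mulg1 //; apply/eqP/commgP/commute_sym/D_central.
rewrite !commMl ?groupM ?groupX ?(sub_DG Dc) ?(sub_DG Dc') //.
rewrite (commD1l Dc) ?groupM ?groupX ?(sub_DG Dc') // mulg1.
rewrite !commXl ?groupM ?groupX ?(sub_DG Dc') // !comm_r //.
rewrite !commgg !expg1n !mul1g !mulg1.
have ex : x = vecD (row3 1%:R 0%:R 0%:R)%R by rewrite vecD_row3 !mulg1.
have ey : y = vecD (row3 0%:R 1%:R 0%:R)%R by rewrite vecD_row3 mulg1 mul1g.
have ez : z = vecD (row3 0%:R 0%:R 1%:R)%R by rewrite vecD_row3 !mul1g.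
rewrite -[[~ a3, a2]]invg_comm -[[~ a1, a3]]invg_comm -[[~ a2, a1]]invg_comm.
rewrite ex ey ez -!vecD_opp -!(vecD_nat, vecD_add); congr vecD.
by rewrite !(row3N, row3Z, row3D); congr row3; ring.
Qed.

Lemma vecD_im : vecD @* setT = D.
Proof.
apply/eqP; rewrite eqEsubset; apply/andP; split.
  by apply/subsetP=> _ /morphimP[u _ _ ->]; apply: vecD_in.
rewrite gen_subG; apply/subsetP=> _ /imset2P[g h Gg Gh ->].
have [i [j [k cg]]] := coords_exists Gg; have [i' [j' [k' ch]]] := coords_exists Gh.
by rewrite (coords_comm cg ch) mem_morphim ?inE.
Qed.

(** A surjection between sets of the same size p^3. *)
Lemma vecD_inj : 'injm vecD.
Proof.
by rewrite -card_im_injm vecD_im oD cardsT card_mx card_Fp // mul1n.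
Qed.

Lemma vecD_eq1 u : vecD u = 1 -> u = 0%R.
Proof.
move=> u1; apply: (injmP vecD_inj); rewrite ?inE //.
exact: etrans u1 (esym vecD0).
Qed.

(** Turns ranks over F_p into orders of subgroups of [G']. *)
Lemma card_vecD_rowg r (A : 'M_(r, 3)) : #|vecD @* rowg A| = (p ^ \rank A)%N.
Proof. by rewrite card_injm ?subsetT ?vecD_inj // card_rowg card_Fp. Qed.

Lemma vecD_scale (H : {group gT}) (a : 'F_p) u : vecD u \in H -> vecD (a *: u)%R \in H.
Proof. by move=> Hu; rewrite -[a]natr_Zp vecD_nat groupX. Qed.

Lemma vecD_rowg_sub (H : {group gT}) (r1 r2 r3 : 'rV['F_p]_3) :
    vecD r1 \in H -> vecD r2 \in H -> vecD r3 \in H ->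
  vecD @* rowg (r1 + r2 + r3)%MS \subset H :&: D.
Proof.
move=> H1 H2 H3; apply/subsetP=> _ /morphimP[u _ + ->].
rewrite mem_rowg inE vecD_in andbT => /sub_addsmxP[[u1 u2] /= ->].
have /sub_addsmxP[[v1 v2] /= ->] : ((u1 *m (r1 + r2)%MS)%R <= r1 + r2)%MS.
  exact: submxMl.
rewrite (mx11_scalar v1) (mx11_scalar v2) (mx11_scalar u2) !mul_scalar_mx !vecD_add.
by apply: groupM; first apply: groupM; apply: vecD_scale.
Qed.

Lemma expgq_D c e : 0 < e -> c \in D -> c ^+ (p ^ e) = 1.
Proof. by case: e => // e _ Dc; rewrite expnS expgM D_expp // expg1n. Qed.

(** In class 2 the defect is a commutator raised to ['C(p ^ m, 2)], a multiple of p because 0 < n <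
    m gives 1 < m. *)
Lemma expgqM g h : g \in G -> h \in G -> (g * h) ^+ (p ^ m) = g ^+ (p ^ m) * h ^+ (p ^ m).
Proof.
move=> Gg Gh; rewrite expMg_Rmul; last 2 first.
- by apply/commute_sym/D_central; rewrite ?commD.
- by apply/commute_sym/D_central; rewrite ?commD.
have /dvdnP[e ->] : (p %| 'C(p ^ m, 2))%N.
  by rewrite dvdn_bin2_expn // (leq_ltn_trans n_gt0).
by rewrite mulnC expgM D_expp ?commD // expg1n mulg1.
Qed.

(** The coordinate along [a3] contributes nothing: [a3 ^+ (p ^ n)] is in [G'], and the remaining
    exponent [p ^ (m - n)] kills it. *)
Lemma coords_expq g i j k : coords g i j k ->
  g ^+ (p ^ m) = vecD (i%:R *: w1 + j%:R *: w2)%R.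
Proof.
case/coordsP=> c Dc ->; have m_gt0 : 0 < m by apply: leq_ltn_trans n_lt_m.
rewrite !expgqM ?groupM ?groupX ?(sub_DG Dc) // (expgq_D m_gt0 Dc) mulg1.
rewrite -!expgM ![(_ * p ^ m)%N]mulnC !expgM ew1 ew2 -!vecD_nat -vecD_add.
rewrite -(subnKC (ltnW n_lt_m)) expnD (expgM a3) ew3 expgq_D ?subn_gt0 ?vecD_in //.
by rewrite expg1n mulg1.
Qed.

Lemma expp_central g h l : g \in G -> h \in G -> commute (g ^+ (p * l)) h.
Proof.
move=> Gg Gh; apply/commgP; rewrite commXl // expgM D_expp ?expg1n //.
exact: commD.
Qed.

Lemma expg_pn_a3 u l c : u \in G -> c \in D ->
  (u ^+ (p * l) * a3 * c) ^+ (p ^ n) = u ^+ (p * l * p ^ n) * vecD w3.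
Proof.
move=> Gu Dc; rewrite expgMn; last by apply/commute_sym/D_central; rewrite ?groupM ?groupX.
rewrite (expgq_D n_gt0 Dc) mulg1 expgMn; last exact: expp_central.
by rewrite -expgM ew3.
Qed.

(** * Upper bounds for the index of a nonabelian subgroup *)

Lemma coords_mem (M : {group gT}) g h i j k :
  D \subset M -> coords g i j k -> coords h i j k -> g \in M -> h \in M.
Proof.
move=> sDM /coordsP[c Dc ->] /coordsP[d Dd ->].
by rewrite (groupMr _ (subsetP sDM _ Dc)) (groupMr _ (subsetP sDM _ Dd)).
Qed.

Lemma coordsE i j k : coords (a1 ^+ i * a2 ^+ j * a3 ^+ k) i j k.
Proof.
split; first by rewrite !groupM ?groupX.
by rewrite !morphM ?morphX ?nDG ?groupM ?groupX.
Qed.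

Lemma sub_gen (M : {group gT}) :
  D \subset M -> a1 \in M -> a2 \in M -> a3 \in M -> G \subset M.
Proof.
by move=> sDM Ma1 Ma2 Ma3; rewrite (subset_trans genG) // !mul_subG ?cycle_subG.
Qed.

Lemma vecD_comm g h : g \in G -> h \in G -> exists u, [~ g, h] = vecD u.
Proof.
move=> Gg Gh; have /morphimP[u _ _ ->] : [~ g, h] \in vecD @* setT.
  by rewrite vecD_im commD.
by exists u.
Qed.

(** A determinant prime to p lets [g] and [h] produce [a1] and [a2] modulo [a3] and [G'], so
    [index_le] applies with [a3] and [p ^ n]. The three rows are the commutator and the two p^m-th
    powers. *)
Lemma index_case_a3 (H : {group gT}) g h i j k i' j' k' u :
    H \subset G -> g \in H -> h \in H -> coords g i j k -> coords h i' j' k' ->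
    (i%:R * j'%:R - j%:R * i'%:R != 0 :> 'F_p)%R -> [~ g, h] = vecD u ->
  #|G : H| * p ^ \rank (u + (i%:R *: w1 + j%:R *: w2)%R + (i'%:R *: w1 + j'%:R *: w2)%R)%MS
     <= p ^ (n + 3).
Proof.
move=> sHG Hg Hh cg ch nz_det eu.
rewrite -card_vecD_rowg expnD -oD.
have q_gt0 : 0 < p ^ m by rewrite expn_gt0 prime_gt0.
pose M := (H <*> D <*> <[a3]>)%G.
have sDM : D \subset M by rewrite (subset_trans (joing_subr H D)) ?joing_subl.
have sHM : H \subset M by rewrite (subset_trans (joing_subl H D)) ?joing_subl.
have Ma3 : a3 \in M by rewrite -cycle_subG joing_subr.
have q0 := pred_expn_Fp p_pr (leq_ltn_trans (leq0n n) n_lt_m).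
have mod0 s t : (s * t + (p ^ m).-1 * t * s = 0 %[mod p ^ m])%N.
  have -> : (s * t + (p ^ m).-1 * t * s = (p ^ m).-1.+1 * (s * t))%N.
    by rewrite mulSn mulnAC mulnA.
  by rewrite prednK // modnMr mod0n.
have Mr s t : g ^+ s * h ^+ t \in M by rewrite groupM ?groupX ?(subsetP sHM).
apply: (@index_le _ G H _ a3); rewrite ?expn_gt0 ?prime_gt0 //.
- apply: vecD_rowg_sub.
  + by rewrite -eu groupR.
  + by rewrite -(coords_expq cg) groupX.
  + by rewrite -(coords_expq ch) groupX.
- apply: (@sub_gen M) => //.
  (* Multiplying [g ^+ j'] by [h] to the exponent -j cancels the coordinate along [a2] and leaves
     the determinant along [a1]. *)
  + have cgh := coordsM (coordsX j' cg) (coordsX ((p ^ m).-1 * j) ch).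
    have {}cgh := coords_mod erefl (mod0 _ _) erefl cgh.
    have := coords_mem sDM cgh (coordsE _ _ _) (Mr _ _).
    rewrite (groupMr _ (groupX _ Ma3)) mulg1; apply: coprime_expg_mem.
      exact: mem_p_elt pG Ga1.
    apply: (Fp_coprime p_pr); apply: contra nz_det => /eqP e0; apply/eqP.
    by rewrite -[RHS]e0 natrD !natrM q0; ring.
  + have cgh := coordsM (coordsX i' cg) (coordsX ((p ^ m).-1 * i) ch).
    have {}cgh := coords_mod (mod0 _ _) erefl erefl cgh.
    have := coords_mem sDM cgh (coordsE _ _ _) (Mr _ _).
    rewrite (groupMr _ (groupX _ Ma3)) mul1g; apply: coprime_expg_mem.
      exact: mem_p_elt pG Ga2.
    apply: (Fp_coprime p_pr); apply: contra nz_det => /eqP e0; apply/eqP.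
    rewrite -[RHS]oppr0 -[in RHS]e0 natrD !natrM q0; ring.
- by rewrite (subsetP (joing_subr H D)) ?a3q.
Qed.

(* If u^(p l) has order above p^n modulo G', then h^(p^n) brings a proper power
   of u into H G'; the drop in |G : H G'| makes up for the row that is lost. *)
Lemma index_case_central (H : {group gT}) g h u (s t : 'F_p) i j l c d :
    H \subset G -> g \in H -> h \in H -> u \in G -> c \in D ->
    h = u ^+ (p * l) * a3 * c -> coords g i j 0 ->
    [~ g, h] = vecD (row3 j%:R (- i%:R) 0)%R ->
    u ^+ (p ^ m) = vecD (s *: w1 + t *: w2)%R ->
    G \subset H <*> D <*> <[u]> ->
    (forall l1 l2 : 'F_p, d <= \rank ((row3 j%:R (- i%:R) 0)%R + (i%:R *: w1 + j%:R *: w2)%R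
                                      + (w3 + l1 *: w1 + l2 *: w2)%R)) ->
  #|G : H| * p ^ d <= p ^ (m + 3).
Proof.
move=> sHG Hg Hh Gu Dc eh cg egh eu sGHu ranks.
have p_gt0 := prime_gt0 p_pr; have m_gt0 := leq_ltn_trans (leq0n n) n_lt_m.
have Hgh : vecD (row3 j%:R (- i%:R) 0)%R \in H by rewrite -egh groupR.
have Hgq : vecD (i%:R *: w1 + j%:R *: w2)%R \in H by rewrite -(coords_expq cg) groupX.
have hq : h ^+ (p ^ n) = u ^+ (p * l * p ^ n) * vecD w3 by rewrite eh expg_pn_a3.
(* If [p ^ m] divides the exponent, [h ^+ (p ^ n)] lies in [G'] and supplies the third row, with
   [l1 = e s] and [l2 = e t]. *)
have [/dvdnP[e el] | ndv] := boolP (p ^ m %| p * l * p ^ n).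
  have Hhq : vecD (w3 + (e%:R * s) *: w1 + (e%:R * t) *: w2)%R \in H.
    have -> : (w3 + (e%:R * s) *: w1 + (e%:R * t) *: w2
               = e%:R *: (s *: w1 + t *: w2) + w3)%R.
      by rewrite scalerDr !scalerA addrC addrA addrC addrA.
    by rewrite vecD_add vecD_nat -eu -expgM mulnC -el -hq groupX.
  rewrite expnD -oD (leq_trans _ (index_le _ sHG Gu (vecD_rowg_sub Hgh Hgq Hhq) sGHu _)) //.
  - by rewrite card_vecD_rowg leq_mul2l leq_exp2l ?prime_gt1 // ranks orbT.
  - by rewrite expn_gt0 p_gt0.
  - by rewrite eu (subsetP (joing_subr H D)) ?vecD_in.
have L_gt0 : 0 < p * l * p ^ n.
  by case: (posnP (p * l * p ^ n)) ndv => // ->; rewrite dvdn0.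
have ltem : logn p (p * l * p ^ n) < m by rewrite ltnNge -pfactor_dvdn.
set M := (H <*> D)%G.
(* The exponent is [p ^ v] times a number prime to p, with v < m, so [M] contains [u ^+ (p ^ v)] and
   with it this power. *)
have Mu : u ^+ (p ^ m.-1) \in M.
  have le_e : logn p (p * l * p ^ n) <= m.-1 by rewrite -ltnS prednK.
  rewrite -(subnKC le_e) expnD expgM groupX //.
  have [L' copL' eL] := pfactor_coprime p_pr L_gt0.
  apply: (@coprime_expg_mem _ p L').
  - by rewrite (mem_p_elt pG) ?groupX.
  - by [].
  rewrite -expgM mulnC -eL.
  rewrite -(groupMr _ (subsetP (joing_subr H D) _ (vecD_in w3))) -hq.
  by rewrite groupX // (subsetP (joing_subl H D)).
(* The zero row stands in for the missing third row. *)
have H1 : vecD 0%R \in H by rewrite vecD0.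
have := index_le _ sHG Gu (vecD_rowg_sub Hgh Hgq H1) sGHu Mu.
rewrite expn_gt0 p_gt0 card_vecD_rowg addsmx0 oD => /(_ isT) le_i.
have {}ranks := ranks 0%R 0%R; rewrite !scale0r !addr0 in ranks.
rewrite addsmxC in ranks; have le_d := leq_trans ranks (rank_adds_row_le _ _).
rewrite -(leq_exp2l _ _ (prime_gt1 p_pr)) in le_d.
rewrite (leq_trans (leq_mul (leqnn _) le_d)) // expnS mulnCA.
have -> : (p ^ (m + 3) = p * (p ^ m.-1 * p ^ 3))%N.
  by rewrite mulnA -expnS prednK // expnD.
by rewrite leq_mul2l le_i orbT.
Qed.

(* d bounds the quantity D of the header from below. *)
Definition rank_bound d := forall al be l1 l2 : 'F_p, ((al != 0) || (be != 0))%R ->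
  d <= \rank ((row3 be (- al) 0)%R + (al *: w1 + be *: w2)%R
              + (w3 + l1 *: w1 + l2 *: w2)%R).

(** A vanishing determinant makes the first two coordinates of [g] and [h] proportional modulo p, so
    other elements of [H] can be chosen that meet the hypotheses of [index_case_central]. *)
Lemma index_case_line (H : {group gT}) g h i j k i' j' k' d :
    H \subset G -> g \in H -> h \in H -> [~ g, h] != 1 ->
    coords g i j k -> coords h i' j' k' ->
    (i%:R * j'%:R - j%:R * i'%:R = 0 :> 'F_p)%R ->
    ((i%:R != 0 :> 'F_p) || (j%:R != 0 :> 'F_p))%R -> rank_bound d ->
  #|G : H| * p ^ d <= p ^ (m + 3).
Proof.
move=> sHG Hg Hh ncgh cg ch det0 nz_ij bound_d.
have p_gt0 := prime_gt0 p_pr; have m_gt0 := leq_ltn_trans (leq0n n) n_lt_m.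
have q_gt0 r : 0 < p ^ r by rewrite expn_gt0 p_gt0.
pose minus r e := ((p ^ r).-1 * e)%N.
have minusK r e f : (e = f %[mod p ^ r] -> e + minus r f = 0 %[mod p ^ r])%N.
  move=> ef; rewrite -modnDml ef modnDml /minus -mulSn prednK //.
  by rewrite modnMr mod0n.
(* Normalise h to u^(p l) a3 with u = a2 or u = a1, then g to a1^i a2^j. *)
have [h1 [I [J [K [[Hh1 nc1 ch1] det1 IJ]]]]] : exists h1 I J K,
    [/\ [/\ h1 \in H, [~ g, h1] != 1 & coords h1 I J K],
        (i%:R * J%:R - j%:R * I%:R = 0 :> 'F_p)%R
      & ((i%:R != 0 :> 'F_p)%R /\ I = 0) \/ ((j%:R != 0 :> 'F_p)%R /\ J = 0)].
  have ncE r : [~ g, h * g ^+ r] != 1.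
    by rewrite commMr ?groupX ?(subsetP sHG) // commgXg mulg1.
  have mulE e t s : (e * s = 1 %[mod p ^ m] -> t + minus m (e * t) * s = 0 %[mod p ^ m])%N.
    move=> es; rewrite /minus -!mulnA -/(minus m _); apply: minusK.
    by rewrite mulnCA mulnC -modnMml es modnMml mul1n.
  have detE r I J :
      ((i' + r * i)%N%:R = I :> 'F_p)%R -> ((j' + r * j)%N%:R = J :> 'F_p)%R ->
      (i%:R * J - j%:R * I = 0 :> 'F_p)%R.
    by move=> <- <-; rewrite -det0 !natrD !natrM; ring.
  have Fmod s t : (s = t %[mod p ^ m] -> s%:R = t%:R :> 'F_p)%N%R.
    move=> st; rewrite -(Fp_nat_mod p_pr s) -(Fp_nat_mod p_pr t).
    by rewrite -(modn_dvdm s (dvdn_exp m_gt0 (dvdnn p))) st modn_dvdm ?dvdn_exp.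
  case/orP: nz_ij => nz.
    have [e ei] := inv_mod_expn p_pr m (Fp_coprime p_pr nz).
    set r := minus m (e * i')%N.
    exists (h * g ^+ r), 0, (j' + r * j)%N, (k' + r * k)%N; split; last by left.
      split; rewrite ?groupM ?groupX //.
      by apply: coords_mod (coordsM ch (coordsX _ cg)) => //; apply: mulE.
    by apply: (@detE r) => //; apply: Fmod; apply: mulE.
  have [e ej] := inv_mod_expn p_pr m (Fp_coprime p_pr nz).
  set r := minus m (e * j')%N.
  exists (h * g ^+ r), (i' + r * i)%N, 0, (k' + r * k)%N; split; last by right.
    split; rewrite ?groupM ?groupX //.
    by apply: coords_mod (coordsM ch (coordsX _ cg)) => //; apply: mulE.
  by apply: (@detE r) => //; apply: Fmod; apply: mulE.
(* One of [I], [J] is 0 and the determinant kills the other modulo p, so [K] divisible by p would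
   make the commutator trivial. *)
have nzK : (K%:R != 0 :> 'F_p)%R.
  apply: contra nc1 => /eqP K0; rewrite (coords_comm cg ch1) K0 det1 -vecD0.
  case: IJ det1 => [[nz ->]|[nz ->]]; rewrite mulr0 ?(sub0r, subr0) => /eqP.
    rewrite mulf_eq0 (negPf nz) => /eqP ->.
    by apply/eqP; congr vecD; apply: row3P; rewrite row3E !mxE; ring.
  rewrite oppr_eq0 mulf_eq0 (negPf nz) => /eqP ->.
  by apply/eqP; congr vecD; apply: row3P; rewrite row3E !mxE; ring.
(* Inverting [K] modulo [p ^ n] normalises the exponent of [a3] to 1; a power of the result then
   removes [a3] from [g]. *)
have [f fK] := inv_mod_expn p_pr n (Fp_coprime p_pr nzK).
have {nc1 Hh1 ch1} [h2 [Hh2 ch2]] : exists h2, h2 \in H /\ coords h2 (f * I)%N (f * J)%N 1.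
  by exists (h1 ^+ f); split; [rewrite groupX | apply: coords_mod (coordsX f ch1)].
set s := minus n k.
have cg2 : coords (g * h2 ^+ s) (i + s * (f * I))%N (j + s * (f * J))%N 0.
  apply: coords_mod (coordsM cg (coordsX s ch2)) => //.
  by rewrite muln1; apply: minusK.
have Hg2 : g * h2 ^+ s \in H by rewrite groupM ?groupX.
set g2 := g * _ in cg2 Hg2.
pose M u := (H <*> D <*> <[u]>)%G.
have sDM u : D \subset M u by rewrite (subset_trans (joing_subr H D)) ?joing_subl.
have sHM u : H \subset M u by rewrite (subset_trans (joing_subl H D)) ?joing_subl.
have uM u : u \in M u by rewrite -cycle_subG joing_subr.
case: IJ det1 cg2 ch2 => [[nz ->]|[nz ->]]; rewrite !muln0 ?addn0 mulr0 ?(sub0r, subr0).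
  (* Here [i] is a unit modulo p, so [J] is a multiple of p and [h2] has the required shape with
     [u = a2]. *)
  move/eqP; rewrite mulf_eq0 (negPf nz) (Fp_nat_eq0 p_pr) => /dvdnP[l ->] cg2 ch2.
  have fl : (f * (l * p) = p * (l * f))%N by rewrite mulnC -mulnA [RHS]mulnCA.
  rewrite fl in cg2 ch2; have [c Dc eh2] := coordsP ch2; rewrite mul1g in eh2.
  have eg2 := coords_comm cg2 ch2.
  apply: (@index_case_central H g2 h2 a2 0%R 1%R _ _ (l * f)%N c) (cg2) _ _ _ _ => //.
  - rewrite eg2; congr vecD; rewrite natrM pchar_Fp_0 //; congr row3; ring.
  - by rewrite scale0r add0r scale1r.
  - apply: (@sub_gen (M a2)) => //.
      apply: (@coprime_expg_mem _ p i); rewrite ?(mem_p_elt pG) ?Fp_coprime //.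
      have := coords_mem (sDM a2) cg2 (coordsE _ _ _) (subsetP (sHM _) _ Hg2).
      by rewrite mulg1 (groupMr _ (groupX _ (uM a2))).
    have := coords_mem (sDM a2) ch2 (coordsE _ _ _) (subsetP (sHM _) _ Hh2).
    by rewrite mul1g (groupMl _ (groupX _ (uM a2))).
  - by move=> l1 l2; apply: bound_d; rewrite nz.
move/eqP; rewrite oppr_eq0 mulf_eq0 (negPf nz) (Fp_nat_eq0 p_pr) => /dvdnP[l ->] cg2 ch2.
have fl : (f * (l * p) = p * (l * f))%N by rewrite mulnC -mulnA [RHS]mulnCA.
rewrite fl in cg2 ch2; have [c Dc eh2] := coordsP ch2; rewrite mulg1 in eh2.
have eg2 := coords_comm cg2 ch2.
apply: (@index_case_central H g2 h2 a1 1%R 0%R _ _ (l * f)%N c) (cg2) _ _ _ _ => //.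
- rewrite eg2; congr vecD; rewrite natrM pchar_Fp_0 //; congr row3; ring.
- by rewrite scale0r addr0 scale1r.
- apply: (@sub_gen (M a1)) => //.
    apply: (@coprime_expg_mem _ p j); rewrite ?(mem_p_elt pG) ?Fp_coprime //.
    have := coords_mem (sDM a1) cg2 (coordsE _ _ _) (subsetP (sHM _) _ Hg2).
    by rewrite mulg1 (groupMl _ (groupX _ (uM a1))).
  have := coords_mem (sDM a1) ch2 (coordsE _ _ _) (subsetP (sHM _) _ Hh2).
  by rewrite mulg1 (groupMl _ (groupX _ (uM a1))).
- by move=> l1 l2; apply: bound_d; rewrite nz orbT.
Qed.

(** Cases on the determinant of a noncommuting pair modulo p. If it is nonzero, [index_case_a3]
    gains a factor p from n < m, so a rank of at least d - 1 is enough. If it vanishes,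
    [index_case_line] applies to the pair in one of its two orders. *)
Lemma index_nonabelian_le (H : {group gT}) d :
  H \subset G -> ~~ abelian H -> rank_bound d -> #|G : H| * p ^ d <= p ^ (m + 3).
Proof.
move=> sHG /nonabelian_noncommuting[g [h [Hg Hh ncgh]]] bound_d.
have [Gg Gh] := (subsetP sHG g Hg, subsetP sHG h Hh).
have [i [j [k cg]]] := coords_exists Gg; have [i' [j' [k' ch]]] := coords_exists Gh.
have nchg : [~ h, g] != 1 by apply: contra ncgh => /commgP/commute_sym/commgP.
have [det0 | nz_det] := eqVneq (i%:R * j'%:R - j%:R * i'%:R : 'F_p)%R 0%R; last first.
  have [u eu] := vecD_comm Gg Gh.
  have := index_case_a3 sHG Hg Hh cg ch nz_det eu.
  set s := (i%:R *: w1 + _)%R; set s' := (i'%:R *: w1 + _)%R => le_index.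
  have le_d : d <= (\rank (u + s + s')%MS).+1.
    (* Two of the three rows cost at most 2 in rank, so d > 2 makes every nontrivial combination of
       [w1] and [w2] nonzero. *)
    have le_d al be : ((al != 0) || (be != 0))%R ->
        d <= (\rank (al *: w1 + be *: w2)%R).+2.
      move=> nz; rewrite (leq_trans (bound_d al be 0%R 0%R nz)) //.
      rewrite -addsmxA (leq_trans (rank_adds_row_le _ _)) // ltnS addsmxC.
      exact: rank_adds_row_le.
    case: (leqP d 1) => [/leq_trans-> // | d_gt1].
    have u_nz : u != 0%R by apply: contra ncgh => /eqP u0; rewrite eu u0 vecD0.
    have rank_u : \rank u <= \rank (u + s + s')%MS by rewrite mxrankS // -addsmxA addsmxSl.
    rewrite rank_rV u_nz in rank_u.
    case: (leqP d 2) => [/leq_trans-> // | d_gt2].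
    have comb_nz al be : ((al != 0) || (be != 0))%R -> (al *: w1 + be *: w2 != 0)%R.
      move=> /le_d; apply: contraL => /eqP->; rewrite mxrank0.
      by rewrite -ltnNge.
    have nz_ij : ((i%:R != 0 :> 'F_p) || (j%:R != 0 :> 'F_p))%R.
      apply: contraR nz_det; rewrite negb_or !negbK => /andP[/eqP-> /eqP->].
      by rewrite !mul0r subr0.
    have s_nz : s != 0%R := comb_nz _ _ nz_ij.
    (* Otherwise a combination of [w1] and [w2] vanishes whose coefficients are not both zero, by
       the determinant. *)
    have ns's : ~~ (s' <= s)%MS.
      apply: contraL nz_det => /sub_rVP[c es']; rewrite negbK.
      have : ((i'%:R - c * i%:R) *: w1 + (j'%:R - c * j%:R) *: w2 == 0)%R.
        have -> : ((i'%:R - c * i%:R) *: w1 + (j'%:R - c * j%:R) *: w2 = s' - c *: s)%R.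
          by rewrite /s /s' !scalerBl !scalerDr !scalerA opprD addrACA.
        by rewrite es' subrr.
      apply: contraLR => nz_det; apply: comb_nz; apply: contraR nz_det.
      rewrite negb_or !negbK !subr_eq0 => /andP[/eqP-> /eqP->].
      by apply/eqP; ring.
    have : \rank (s' + s)%MS <= \rank (u + s + s')%MS.
      by rewrite mxrankS // addsmxC -addsmxA addsmxSr.
    rewrite rank_adds_row // rank_rV s_nz => rank2.
    (* The rank is at least 2, while d is at most 3, the number of columns. *)
    rewrite (leq_trans (bound_d 1%R 0%R 0%R 0%R _)) ?oner_neq0 //.
    by rewrite (leq_trans (rank_leq_col _)).
  rewrite (leq_trans (leq_mul (leqnn _) (_ : _ <= p ^ (\rank (u + s + s')%MS).+1))) //.
    by rewrite leq_exp2l ?prime_gt1.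
  rewrite expnS mulnCA (leq_trans (leq_mul (leqnn p) le_index)) // -expnS.
  by rewrite leq_exp2l ?prime_gt1 // ltn_add2r.
have [nz | ] := boolP ((i%:R != 0 :> 'F_p) || (j%:R != 0 :> 'F_p))%R.
  exact: index_case_line cg ch det0 nz bound_d.
rewrite negb_or !negbK => /andP[/eqP i0 /eqP j0].
have [nz | ] := boolP ((i'%:R != 0 :> 'F_p) || (j'%:R != 0 :> 'F_p))%R.
  apply: index_case_line ch cg _ nz bound_d => //.
  by rewrite i0 j0 !mulr0 subr0.
rewrite negb_or !negbK => /andP[/eqP i'0 /eqP j'0].
case/negP: ncgh; rewrite (coords_comm cg ch) i0 j0 i'0 j'0 -vecD0.
by apply/eqP; congr vecD; apply: row3P; rewrite row3E !mxE; ring.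
Qed.

(** * I_min and I_max in terms of ranks *)

Hypotheses (sPhiZ : 'Phi(G) \subset 'Z(G)) (oG : #|G| = (p ^ (2 * m + n + 3))%N).

Lemma card_gen2_vecD g h e f r (A : 'M['F_p]_(r, 3)) :
    g \in G -> h \in G -> [~ g, h] \in vecD @* rowg A ->
    g ^+ (p ^ e) \in vecD @* rowg A -> h ^+ (p ^ f) \in vecD @* rowg A ->
  #|<<[set g; h]>>| <= p ^ (e + f + \rank A).
Proof.
move=> Gg Gh Kgh Kg Kh; rewrite !expnD -card_vecD_rowg.
have sKZ : vecD @* rowg A \subset 'Z(G).
  by rewrite (subset_trans _ sDZ) // -vecD_im morphimS ?subsetT.
have nK k : k \in G -> k \in 'N(vecD @* rowg A).
  move=> Gk; apply: (subsetP (cent_sub _)); apply/centP=> c.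
  by move=> /(subsetP sKZ)/setIP[_ /centP/(_ k Gk)]; apply: commute_sym.
by apply: card_gen2_le; rewrite ?nK ?expn_gt0 ?prime_gt0.
Qed.

Lemma vecD_rowg_mem r (A : 'M['F_p]_(r, 3)) u : (u <= A)%MS -> vecD u \in vecD @* rowg A.
Proof. by move=> Au; rewrite mem_morphim ?inE ?mem_rowg. Qed.

Lemma is_Imin_rank k : is_Imin p G k -> (k + \rank (w1 + w2)%MS = n + 2)%N.
Proof.
case=> -[H1 A1H1 oH1] minH; apply/eqP; rewrite eqn_leq; apply/andP; split.
  (* The three rows tried, all with last entry 1, span the whole space, whereas [w1] and [w2] span
     at most a plane. *)
  have [u [u2 nuw]] : exists u : 'rV['F_p]_3, u 0%R (inord 2) = 1%R /\ ~~ (u <= w1 + w2)%MS.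
    have [in0|n0] := boolP ((row3 0 0 1)%R <= w1 + w2)%MS; last first.
      by exists (row3 0 0 1)%R; rewrite row3E.
    have [in1|n1] := boolP ((row3 (-1) 0 1)%R <= w1 + w2)%MS; last first.
      by exists (row3 (-1) 0 1)%R; rewrite row3E.
    have [in2|n2] := boolP ((row3 0 (-1) 1)%R <= w1 + w2)%MS; last first.
      by exists (row3 0 (-1) 1)%R; rewrite row3E.
    have full : ((1%:M : 'M['F_p]_3)%R <= w1 + w2)%MS.
      apply/row_subP=> r; set v := row r _.
      set a := v 0%R (inord 0); set b := v 0%R (inord 1).
      have -> : v = ((a + b + v 0 (inord 2)) *: row3 0 0 1
                     + ((- a) *: row3 (-1) 0 1 + (- b) *: row3 0 (-1) 1))%R.
        rewrite !(row3Z, row3D); apply: row3P; rewrite row3E /a /b; ring.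
      by rewrite addmx_sub ?addmx_sub // scalemx_sub.
    have := leq_trans (mxrankS full) (mxrank_adds_leqif _ _).1.
    rewrite mxrank1 leqNgt => /negP[].
    by rewrite (leq_ltn_trans (leq_add (rank_leq_row _) (rank_leq_row _))).
  (* The commutator of [a1 a3^c] and [a2 a3^e] has coordinates (-c, -e, 1), which is [u]; its last
     entry is the determinant in [index_case_a3]. *)
  set c := nat_of_ord (- u 0 (inord 0))%R; set e := nat_of_ord (- u 0 (inord 1))%R.
  have cg := coordsM coords_a1 (coordsX c coords_a3).
  have ch := coordsM coords_a2 (coordsX e coords_a3).
  rewrite !muln0 !muln1 in cg ch; set g := a1 * _ in cg; set h := a2 * _ in ch.
  have egh : [~ g, h] = vecD u.
    rewrite (coords_comm cg ch) !add0n; congr vecD.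
    by apply: row3P; rewrite row3E ?u2 /c /e ?natr_Zp; ring.
  have u_nz : u != 0%R.
    by apply: contraNneq nuw => ->; rewrite sub0mx.
  have ncgh : [~ g, h] != 1.
    rewrite egh; by apply: contra u_nz => /eqP/vecD_eq1->.
  have [[Gg _] [Gh _]] := (cg, ch).
  pose H := <<[set g; h]>>%G.
  have A1H : A1_subgroup G H by apply: (A1_subgroup_gen2 p_pr).
  have [Hg Hh]: g \in H /\ h \in H by rewrite !mem_gen // !inE eqxx ?orbT.
  have /andP[sHG _] := A1H.
  have := index_case_a3 sHG Hg Hh cg ch _ egh.
  rewrite !scale1r !scale0r addr0 add0r -addsmxA rank_adds_row //.
  rewrite mulr1 mulr0 subr0 oner_neq0 => /(_ isT).
  move/(leq_trans (leq_mul (minH H A1H) (leqnn _))).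
  by rewrite -expnD leq_exp2l ?prime_gt1 // addnS (addnS n 2) ltnS.
(* Conversely, the p^m-th powers of both generators lie in the span of [w1] and [w2], and the
   commutator adds at most one dimension; this bounds the order from above. *)
have [g [h [Gg Gh ncgh eH]]] := A1_subgroup_gen A1H1.
have [i [j [k1 cg]]] := coords_exists Gg; have [i' [j' [k2 ch]]] := coords_exists Gh.
have [u eu] := vecD_comm Gg Gh.
have subw s t : ((s *: w1 + t *: w2)%R <= u + (w1 + w2))%MS.
  by rewrite (submx_trans _ (addsmxSr _ _)) // addmx_sub_adds ?scalemx_sub.
have := @card_gen2_vecD g h m m _ (u + (w1 + w2))%MS Gg Gh.
rewrite (coords_expq cg) (coords_expq ch) eu.
rewrite !vecD_rowg_mem ?subw ?addsmxSl // => /(_ isT isT isT); rewrite -eH => oH.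
have /andP[sHG _] := A1H1.
have := Lagrange sHG; rewrite oH1 oG => oG'.
have : p ^ (2 * m + n + 3) <= p ^ (m + m + (\rank (w1 + w2)%MS).+1 + k).
  rewrite -oG' expnD leq_mul2r; apply/orP; right; rewrite (leq_trans oH) //.
  by rewrite leq_exp2l ?prime_gt1 // leq_add2l rank_adds_row_le.
rewrite leq_exp2l ?prime_gt1 // mul2n -addnn -!addnA !leq_add2l.
by rewrite (addnS n 2) addSn ltnS [(k + _)%N]addnC.
Qed.

Lemma is_Imax_le k d : is_Imax p G k -> rank_bound d -> k + d <= m + 3.
Proof.
case=> -[H A1H oH] _ /index_nonabelian_le; case/and3P: A1H => sHG nabH _.
by move=> /(_ H sHG nabH); rewrite oH -expnD leq_exp2l ?prime_gt1.
Qed.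

(** The subgroup generated by [a1^al a2^be] and [a3] realises the triple with [l1 = l2 = 0];
    bounding its order from above bounds its index from below. *)
Lemma is_Imax_ge k (al be : 'F_p) :
    is_Imax p G k -> ((al != 0) || (be != 0))%R ->
  m + 3 <= k + \rank ((row3 be (- al) 0)%R + (al *: w1 + be *: w2)%R + w3).
Proof.
case=> _ maxH nz; set A := (_ + w3)%MS.
have cg := coordsM (coordsX al coords_a1) (coordsX be coords_a2).
rewrite !muln0 !muln1 addn0 in cg; set g := _ * _ in cg.
have egh : [~ g, a3] = vecD (row3 be (- al) 0)%R.
  rewrite (coords_comm cg coords_a3) !natr_Zp; congr (vecD (row3 _ _ _)); ring.
have ncgh : [~ g, a3] != 1.
  rewrite egh; apply: contraL nz => /eqP/vecD_eq1/rowP u0; rewrite negb_or !negbK.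
  have := u0 (inord 0); have := u0 (inord 1); rewrite !row3E !mxE => /eqP.
  by rewrite oppr_eq0 => -> ->; rewrite eqxx.
have [Gg _] := cg; pose H := <<[set g; a3]>>%G.
have A1H : A1_subgroup G H by apply: (A1_subgroup_gen2 p_pr).
have /andP[sHG _] := A1H.
have := @card_gen2_vecD g a3 m n _ A Gg Ga3.
rewrite (coords_expq cg) egh ew3 !natr_Zp !vecD_rowg_mem.
- move=> /(_ isT isT isT) oH.
  have : p ^ (2 * m + n + 3) <= p ^ (m + n + \rank A + k).
    by rewrite -oG -(Lagrange sHG) expnD leq_mul ?maxH.
  rewrite leq_exp2l ?prime_gt1 // mul2n -addnn -!addnA leq_add2l addnCA.
  by rewrite leq_add2l [(k + _)%N]addnC.
- by rewrite /A addsmxSr.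
- by rewrite /A -addsmxA addsmxC -addsmxA addsmxSl.
- by rewrite /A -addsmxA addsmxSl.
Qed.

End CharMatrix.

(** * Ranks of triples containing the normal (be, -al, 0) *)

Section Row3Span.

Variable F : fieldType.
Implicit Types a b c d : F.

Lemma row3_subP a b c a' b' c' :
  reflect (exists d, [/\ a = d * a', b = d * b' & c = d * c']%R)
    (row3 a b c <= row3 a' b' c')%MS.
Proof.
apply: (iffP sub_rVP) => -[d].
  rewrite row3Z => /rowP e; exists d.
  by have := (e (inord 0), e (inord 1), e (inord 2)); rewrite !row3E => -[[-> ->] ->].
by case=> -> -> ->; exists d; rewrite row3Z.
Qed.

Lemma row3_eq0 a b c : (row3 a b c == 0)%R = [&& a == 0, b == 0 & c == 0]%R.
Proof.
apply/eqP/and3P => [/rowP e | [/eqP-> /eqP-> /eqP->]]; last first.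
  by apply: row3P; rewrite row3E mxE.
by have := (e (inord 0), e (inord 1), e (inord 2)); rewrite !row3E !mxE => -[[-> ->] ->].
Qed.

Lemma rank_row3_minor a b c a' b' c' :
    [|| a * b' - b * a' != 0, a * c' - c * a' != 0 | b * c' - c * b' != 0]%R ->
  \rank (row3 a b c + row3 a' b' c')%MS = 2.
Proof.
move=> minor; rewrite rank_adds_row ?rank_rV ?row3_eq0.
  case: (boolP [&& _, _ & _]) => // /and3P[/eqP a0 /eqP b0 /eqP c0].
  by move: minor; rewrite a0 b0 c0 !mulr0 subrr eqxx.
apply: contraL minor => /row3_subP[d [-> -> ->]]; rewrite !negb_or !negbK.
by apply/and3P; split; apply/eqP; ring.
Qed.

Lemma rank_rows_le1 (u s t : 'rV[F]_3) :
  (s <= u)%MS -> (t <= u)%MS -> \rank (u + s + t)%MS <= 1.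
Proof.
move=> su tu; apply: leq_trans (rank_leq_row u); apply: mxrankS.
by rewrite !addsmx_sub submx_refl su.
Qed.

Lemma rank_rows_le2 (u s t : 'rV[F]_3) :
  (s <= u)%MS || (t <= u)%MS -> \rank (u + s + t)%MS <= 2.
Proof.
have le2 (v : 'rV[F]_3) : \rank (u + v)%MS <= 2.
  by rewrite (leq_trans (rank_adds_row_le _ _)) // ltnS rank_leq_row.
case/orP=> sub; [apply: leq_trans (le2 t) | apply: leq_trans (le2 s)]; apply: mxrankS.
  by rewrite addsmxS // addsmx_sub submx_refl.
by rewrite addsmx_sub submx_refl (submx_trans sub) ?addsmxSl.
Qed.

Section Normal.

Variables al be : F.
Hypothesis nz : ((al != 0) || (be != 0))%R.
Let u := row3 be (- al)%R 0%R.

Lemma normal_nz : u != 0%R.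
Proof.
by rewrite row3_eq0 oppr_eq0 eqxx andbT; case/orP: nz => /negPf->; rewrite ?andbF.
Qed.

Lemma rank_normal_ge1 (s t : 'rV[F]_3) : 1 <= \rank (u + s + t)%MS.
Proof.
have : \rank u <= \rank (u + s + t)%MS by rewrite mxrankS // -addsmxA addsmxSl.
by rewrite rank_rV normal_nz.
Qed.

(** [u] spans the orthogonal complement of (al, be, 0) and (0, 0, 1). *)
Lemma normal_sub s0 s1 s2 :
  (row3 s0 s1 s2 <= u)%MS = (s0 * al + s1 * be == 0)%R && (s2 == 0)%R.
Proof.
apply/row3_subP/andP=> [[d [-> -> ->]] | [/eqP e /eqP->]].
  by rewrite mulr0; split=> //; apply/eqP; ring.
have [be0 | be_nz] := eqVneq be 0%R.
  move: nz e; rewrite be0 eqxx orbF mulr0 addr0 => al_nz /eqP.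
  rewrite mulf_eq0 (negPf al_nz) orbF => /eqP->; exists (- s1 / al)%R.
  by split; rewrite ?mulr0 // mulNr mulrNN divfK.
exists (s0 / be)%R; split; rewrite ?mulr0 ?divfK //.
apply: (mulIf be_nz); apply/eqP; rewrite -subr_eq0 -[X in _ == X]e; apply/eqP.
by field.
Qed.

Lemma rank_normal_ge2 s0 s1 s2 t0 t1 t2 :
    ~ [/\ s0 * al + s1 * be = 0, s2 = 0, t0 * al + t1 * be = 0 & t2 = 0]%R ->
  2 <= \rank (u + row3 s0 s1 s2 + row3 t0 t1 t2)%MS.
Proof.
move=> not_sub; set s := row3 s0 s1 s2; set t := row3 t0 t1 t2.
have ge2 (v : 'rV[F]_3) : ~~ (v <= u)%MS -> (v + u <= u + s + t)%MS ->
    2 <= \rank (u + s + t)%MS.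
  by move=> nvu /mxrankS; rewrite rank_adds_row // rank_rV normal_nz.
have [su|nsu] := boolP (s <= u)%MS; last first.
  by apply: (ge2 s); rewrite // addsmxC addsmxSl.
have [tu|ntu] := boolP (t <= u)%MS; last first.
  by apply: (ge2 t); rewrite // addsmx_sub addsmxSr -addsmxA addsmxSl.
case: not_sub; move: su tu; rewrite !normal_sub.
by move=> /andP[/eqP-> /eqP->] /andP[/eqP-> /eqP->].
Qed.

(** The first two rows are independent with last entry 0, and the third leaves their plane. *)
Lemma rank_normal_ge3 s0 s1 t0 t1 t2 :
    (s0 * al + s1 * be != 0)%R -> (t2 != 0)%R ->
  3 <= \rank (u + row3 s0 s1 0%R + row3 t0 t1 t2)%MS.
Proof.
move=> nz_s nz_t; rewrite addsmxC rank_adds_row ?(addsmxC u) ?rank_adds_row.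
- by rewrite rank_rV normal_nz.
- by rewrite normal_sub (negPf nz_s).
apply: contra nz_t => /sub_addsmxP[[v1 v2] /=].
rewrite (mx11_scalar v1) (mx11_scalar v2) !mul_scalar_mx /u !row3Z row3D.
by move=> /rowP/(_ (inord 2)); rewrite !row3E !mulr0 addr0 => ->.
Qed.

End Normal.
End Row3Span.

(** * The ranks for each label *)

Definition label_rows (p : nat) (l : label p) : 'rV['F_p]_3 * 'rV['F_p]_3 * 'rV['F_p]_3 :=
  (match l with
  | G1    => (row3 0 (-1) 0, row3 1 0 0, row3 0 0 1)
  | G2 nu => (row3 nu (-1) 0, row3 1 0 0, row3 0 0 1)
  | G3 nu => (row3 1 0 0, row3 0 nu 0, row3 0 0 1)
  | G4 r  => (row3 1 (-1) 0, row3 1 r%:R 0, row3 0 0 1)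
  | G5    => (row3 0 1 0, row3 1 0 0, row3 0 0 1)
  | G6    => (row3 1 0 0, row3 0 1 0, row3 0 0 1)
  | G7    => (row3 1 1 0, row3 0 1 0, row3 0 0 1)
  | G8 t  => (row3 1 0 0, row3 0 0 1, row3 0 t 0)
  | G9    => (row3 0 1 0, row3 0 0 1, row3 1 0 0)
  | H1    => (row3 0 (-1) 0, row3 1 0 0, row3 0 0 0)
  | H2    => (row3 1 (-1) 0, row3 1 0 0, row3 0 0 0)
  | H3 nu => (row3 1 0 0, row3 0 nu 0, row3 0 0 0)
  | H4 r  => (row3 1 (-1) 0, row3 1 r%:R 0, row3 0 0 0)
  | H5    => (row3 0 1 0, row3 1 0 0, row3 0 0 0)
  | H6    => (row3 1 0 0, row3 0 1 0, row3 0 0 0)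
  | H7    => (row3 1 1 0, row3 0 1 0, row3 0 0 0)
  | H8    => (row3 0 0 0, row3 1 0 0, row3 0 0 1)
  | H9 nu => (row3 0 0 0, row3 0 nu 0, row3 0 0 1)
  | H10   => (row3 0 0 0, row3 1 0 0, row3 0 1 0)
  | H11   => (row3 0 0 0, row3 0 1 0, row3 1 0 0)
  | H12   => (row3 1 0 0, row3 0 0 1, row3 0 0 0)
  | H13   => (row3 0 1 0, row3 0 0 1, row3 0 0 0)
  | H14   => (row3 0 0 0, row3 0 0 1, row3 1 0 0)
  | H15 t => (row3 0 0 0, row3 0 0 1, row3 0 t 0)
  | I1    => (row3 0 0 0, row3 0 0 0, row3 0 0 1)
  | I2    => (row3 0 0 0, row3 1 0 0, row3 0 0 0)
  | I3    => (row3 0 0 0, row3 0 1 0, row3 0 0 0)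
  | I4    => (row3 0 0 0, row3 0 0 0, row3 1 0 0)
  | I5    => (row3 0 0 0, row3 0 0 0, row3 0 0 0)
  | I6    => (row3 0 0 0, row3 0 0 1, row3 0 0 0)
  end)%R.

Lemma label_rowsE (p : nat) (l : label p) :
  label_rows l = (row (inord 0) (label_mx l), row (inord 1) (label_mx l),
                  row (inord 2) (label_mx l)).
Proof.
by case: l => *; congr (_, _, _); apply: row3P;
  rewrite row3E !mxE -?val_eqE /= ?inordK //= ?(mulr0, mulr1, oppr0, addr0, add0r).
Qed.

(** I_min equals [m3 + 2] minus this number. *)
Definition rows12_rank (p : nat) (l : label p) : nat :=
  match l with
  | I1 | I4 | I5 => 0
  | H8 | H9 _ | H10 | H11 | H14 | H15 _ | I2 | I3 | I6 => 1
  | _ => 2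
  end.

(** The quantity D, so that I_max equals [m1 + 3] minus it; the conditions test whether al^2 + c
    be^2 has a nontrivial zero, with c the parameter. *)
Definition min_rank (p : nat) (l : label p) : nat :=
  match l with
  | H1 | H2 | H5 | H6 | H10 | H13 | H15 _ | I2 | I3 | I4 | I5 | I6 => 1
  | H3 nu => if nonzero_square (- nu)%R then 1%N else 2%N
  | H4 r => if nonzero_square (- r%:R : 'F_p)%R then 1%N else 2%N
  | G3 nu => if nonzero_square (- nu)%R then 2%N else 3%N
  | G4 r => if nonzero_square (- r%:R : 'F_p)%R then 2%N else 3%N
  | G7 => 3
  | _ => 2
  end.

(** This is the quadratic form attached to G7 and H7. *)
Lemma F2_form_neq0 (p : nat) (al be : 'F_p) : p = 2 ->
  ((al != 0) || (be != 0))%R -> (al * al + (al + be) * be != 0)%R.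
Proof.
move=> p2; subst p; by case: al be => [[|[|//]] ?] [[|[|//]] ?].
Qed.

Section LabelRanks.

Variables (p : nat) (eta : 'F_p).
Hypotheses (p_pr : prime p).
Hypothesis eta_nonresidue : odd p -> eta != 0%R /\ ~~ nonzero_square eta.

Lemma nu_ok_neq0 nu : nu_ok eta nu -> (nu != 0)%R.
Proof.
by case/orP=> [/eqP->|/andP[/eta_nonresidue[eta_nz _] /eqP->]]; rewrite ?oner_neq0.
Qed.

(** For G4 and H4, [r] is the coefficient of be^2 in the form and [r + 1] is the minor of the first
    two rows. *)
Lemma r_neq0 r : 1 <= r <= p - 2 -> (r%:R != 0 :> 'F_p)%R /\ (r%:R + 1 != 0 :> 'F_p)%R.
Proof.
move=> /andP[r_gt0 r_le]; have p_gt1 := prime_gt1 p_pr.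
have natF_neq0 k : 0 < k < p -> (k%:R != 0 :> 'F_p)%R.
  by case/andP=> k_gt0 k_lt; rewrite Fp_nat_eq0 // gtnNdvd.
split; first by rewrite natF_neq0 // r_gt0 /=; lia.
by rewrite natr1 natF_neq0 //=; lia.
Qed.

Lemma rank_rows12 (l : label p) : admissible eta l ->
  \rank ((label_rows l).1.1 + (label_rows l).1.2)%MS = rows12_rank l.
Proof.
have row0 : (row3 0 0 0 = 0 :> 'rV['F_p]_3)%R by apply/eqP; rewrite row3_eq0 eqxx.
case: l => /=.
all: try by move=> *;
  rewrite row0 ?adds0mx ?mxrank0 ?rank_rV ?row3_eq0 ?oner_eq0 ?eqxx.
all: try by move=> *; apply: rank_row3_minor;
  rewrite !(mul0r, mulr0, mulr1, mul1r) ?(sub0r, subr0, oppr0) ?opprK;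
  rewrite ?oppr_eq0 ?oner_neq0 ?orbT.
- move=> nu /andP[_ /nu_ok_neq0 nz]; apply: rank_row3_minor.
  by rewrite mul1r mul0r subr0 nz.
- move=> r /andP[_ /r_neq0[_ nz]]; apply: rank_row3_minor.
  by rewrite mul1r mulr1 opprK nz.
- move=> nu /andP[_ /nu_ok_neq0 nz]; apply: rank_row3_minor.
  by rewrite mul1r mul0r subr0 nz.
- move=> r /andP[_ /r_neq0[_ nz]]; apply: rank_row3_minor.
  by rewrite mul1r mulr1 opprK nz.
- by move=> nu /nu_ok_neq0 nz; rewrite row0 adds0mx rank_rV row3_eq0 (negPf nz) andbF.
Qed.

(** A zero with [be] nonzero exhibits [- c] as the square of [al / be]; one with [be = 0] has
    [al = 0] too. *)
Lemma sum_squares_neq0 (c al be : 'F_p) : (c != 0)%R -> ~~ nonzero_square (- c)%R ->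
  ((al != 0) || (be != 0))%R -> (al ^+ 2 + c * be ^+ 2 != 0)%R.
Proof.
move=> c_nz nsq nz; apply: contra nsq => /eqP e.
have be_nz : (be != 0)%R.
  apply: contraL nz => /eqP be0; rewrite be0 eqxx orbF negbK; move: e.
  by rewrite be0 expr0n mulr0 addr0 => /eqP; rewrite expf_eq0.
have ec : (- c = (al / be) ^+ 2)%R.
  apply: (mulIf (expf_neq0 2 be_nz)); rewrite -exprMn divfK //.
  by apply/eqP; rewrite -subr_eq0 -oppr_eq0 -[X in _ == X]e; apply/eqP; ring.
apply/existsP; exists (al / be)%R; rewrite ec eqxx andbT.
by apply: contra c_nz => /eqP z0; rewrite -oppr_eq0 ec z0 expr0n.
Qed.

Lemma F2_two : p == 2 -> (1 + 1 = 0 :> 'F_p)%R.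
Proof. by move=> /eqP p2; apply/eqP; rewrite -(natrD _ 1 1) Fp_nat_eq0 // p2. Qed.

Local Notation simp :=
  (mulr0, mul0r, mulr1, mul1r, addr0, add0r, oppr0, eqxx, addNr, subrr) (only parsing).

(** A coordinate axis serves most labels. When G3, G4, H3 or H4 has an isotropic form, the direction
    is [(a, 1)] with [a ^+ 2] equal to [- nu] or [- r]; for G6 and H6 it is [(1, 1)], as 1 + 1 =
    0. *)
Lemma rank_label_le (l : label p) : admissible eta l ->
  exists al be : 'F_p, ((al != 0) || (be != 0))%R /\
    \rank ((row3 be (- al) 0)%R + (al *: (label_rows l).1.1 + be *: (label_rows l).1.2)%R
           + (label_rows l).2)%MS <= min_rank l.
Proof.
have nz10 : ((1 != 0 :> 'F_p) || (0 != 0 :> 'F_p))%R by rewrite oner_neq0.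
have nz01 : ((0 != 0 :> 'F_p) || (1 != 0 :> 'F_p))%R by rewrite oner_neq0 orbT.
have nzx1 a : ((a != 0 :> 'F_p) || (1 != 0 :> 'F_p))%R by rewrite oner_neq0 orbT.
have sqP c : nonzero_square c -> exists a : 'F_p, c = (a ^+ 2)%R.
  by case/existsP=> a /andP[_ /eqP->]; exists a.
case: l => /=.
(* Four sweeps try both axes, first for rank 1, then for rank 2. *)
all: try by move=> *; exists 1%R, 0%R; split=> //; apply: rank_rows_le1;
  rewrite ?(row3Z, row3D) normal_sub // !simp.
all: try by move=> *; exists 0%R, 1%R; split=> //; apply: rank_rows_le1;
  rewrite ?(row3Z, row3D) normal_sub // !simp.
all: try by move=> *; exists 1%R, 0%R; split=> //; apply: rank_rows_le2;
  rewrite ?(row3Z, row3D) !normal_sub // !simp ?orbT.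
all: try by move=> *; exists 0%R, 1%R; split=> //; apply: rank_rows_le2;
  rewrite ?(row3Z, row3D) !normal_sub // !simp ?orbT.
- move=> nu _; case: ifP => [/sqP[a ea]|_].
    exists a, 1%R; split=> //; apply: rank_rows_le2.
    rewrite !(row3Z, row3D) normal_sub // !simp.
    by rewrite -[nu]opprK ea -expr2 subrr eqxx.
  by exists 1%R, 0%R; split=> //; apply: rank_leq_col.
- move=> r _; case: ifP => [/sqP[a ea]|_].
    exists a, 1%R; split=> //; apply: rank_rows_le2.
    rewrite !(row3Z, row3D) normal_sub // !simp andbT -[r%:R%R]opprK ea.
    by apply/orP; left; apply/eqP; ring.
  by exists 1%R, 0%R; split=> //; apply: rank_leq_col.
- move=> /F2_two two0; exists 1%R, 1%R; split=> //; apply: rank_rows_le2.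
  by rewrite !(row3Z, row3D) normal_sub // !simp two0 eqxx.
- by move=> _; exists 1%R, 0%R; split=> //; apply: rank_leq_col.
- move=> nu _; case: ifP => [/sqP[a ea]|_].
    exists a, 1%R; split=> //; apply: rank_rows_le1;
      rewrite ?(row3Z, row3D) normal_sub // !simp //.
    by rewrite -[nu]opprK ea -expr2 subrr eqxx.
  exists 1%R, 0%R; split=> //; apply: rank_rows_le2.
  by rewrite !(row3Z, row3D) !normal_sub // !simp orbT.
- move=> r _; case: ifP => [/sqP[a ea]|_].
    exists a, 1%R; split=> //; apply: rank_rows_le1;
      rewrite ?(row3Z, row3D) normal_sub // !simp //.
    by rewrite andbT -[r%:R%R]opprK ea; apply/eqP; ring.
  exists 1%R, 0%R; split=> //; apply: rank_rows_le2.
  by rewrite !(row3Z, row3D) !normal_sub // !simp orbT.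
- move=> /F2_two two0; exists 1%R, 1%R; split=> //; apply: rank_rows_le1.
    by rewrite !(row3Z, row3D) normal_sub // !simp two0 eqxx.
  by rewrite normal_sub // !simp.
Qed.

Lemma rank_bound_label (l : label p) : admissible eta l ->
  rank_bound (label_rows l).1.1 (label_rows l).1.2 (label_rows l).2 (min_rank l).
Proof.
have sqr_eq0 (x : 'F_p) : (x * x = 0)%R -> x = 0%R.
  by move/eqP; rewrite mulf_eq0 orbb => /eqP.
have both0 (al be : 'F_p) : ((al != 0) || (be != 0))%R ->
    al = 0%R -> be = 0%R -> False.
  by move=> nz al0 be0; rewrite al0 be0 eqxx in nz.
case: l => /=.
(* For rank 1 the nonzero normal suffices. The second sweep takes the labels whose third row has
   last entry 1 whatever [l1] and [l2] are. *)
all: try by move=> *; move=> al be l1 l2 nz; rewrite !(row3Z, row3D);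
  apply: rank_normal_ge1.
all: try by move=> *; move=> al be l1 l2 nz; rewrite !(row3Z, row3D);
  apply: rank_normal_ge2 => // -[_ _ _ /eqP]; rewrite !simp oner_eq0.
- move=> nu /andP[_ /nu_ok_neq0 nu_nz] al be l1 l2 nz; rewrite !(row3Z, row3D) !simp.
  have eq_form : (al * al + be * nu * be = al ^+ 2 + nu * be ^+ 2)%R by ring.
  case: ifP => [_|/negbT nsq].
    by apply: rank_normal_ge2 => // -[_ _ _ /eqP]; rewrite oner_eq0.
  apply: rank_normal_ge3; rewrite ?oner_neq0 // eq_form.
  exact: sum_squares_neq0.
- move=> r /andP[_ /r_neq0[r_nz _]] al be l1 l2 nz; rewrite !(row3Z, row3D) !simp.
  (* The antisymmetric entries cancel, leaving the same diagonal form as for G3. *)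
  have eq_form : ((al + be) * al + (al * -1 + be * r%:R) * be
                  = al ^+ 2 + r%:R * be ^+ 2)%R by ring.
  case: ifP => [_|/negbT nsq].
    by apply: rank_normal_ge2 => // -[_ _ _ /eqP]; rewrite oner_eq0.
  apply: rank_normal_ge3; rewrite ?oner_neq0 // eq_form.
  exact: sum_squares_neq0.
- move=> /eqP p2 al be l1 l2 nz; rewrite !(row3Z, row3D) !simp.
  by apply: rank_normal_ge3; rewrite ?oner_neq0 ?F2_form_neq0.
(* Here, as for G9, H11, H12 and H14 below, rank 1 would put both rows on the line of the normal,
   and the resulting equations force [al = be = 0]. *)
- move=> t _ al be l1 l2 nz; rewrite !(row3Z, row3D) !simp.
  apply: rank_normal_ge2 => // -[e be0 _ _]; apply: (both0 al be) => //.
  by apply: sqr_eq0; rewrite -[RHS]e be0 ?simp.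
- move=> _ al be l1 l2 nz; rewrite !(row3Z, row3D) !simp.
  apply: rank_normal_ge2 => // -[_ be0 e _]; apply: (both0 al be) => //.
  by rewrite -[RHS]e be0 ?simp.
- move=> nu /andP[_ /nu_ok_neq0 nu_nz] al be l1 l2 nz; rewrite !(row3Z, row3D) !simp.
  have eq_form : (al * al + be * nu * be = al ^+ 2 + nu * be ^+ 2)%R by ring.
  case: ifP => [_|/negbT nsq]; first exact: rank_normal_ge1.
  apply: rank_normal_ge2 => // -[/eqP]; rewrite eq_form.
  by rewrite (negPf (sum_squares_neq0 nu_nz nsq nz)).
- move=> r /andP[_ /r_neq0[r_nz _]] al be l1 l2 nz; rewrite !(row3Z, row3D) !simp.
  have eq_form : ((al + be) * al + (al * -1 + be * r%:R) * be
                  = al ^+ 2 + r%:R * be ^+ 2)%R by ring.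
  case: ifP => [_|/negbT nsq]; first exact: rank_normal_ge1.
  apply: rank_normal_ge2 => // -[/eqP]; rewrite eq_form.
  by rewrite (negPf (sum_squares_neq0 r_nz nsq nz)).
- move=> /eqP p2 al be l1 l2 nz; rewrite !(row3Z, row3D) !simp.
  apply: rank_normal_ge2 => // -[/eqP].
  by rewrite (negPf (F2_form_neq0 p2 nz)).
- move=> _ al be l1 l2 nz; rewrite !(row3Z, row3D) !simp.
  apply: rank_normal_ge2 => // -[e0 _ e _].
  have be0 : be = 0%R by apply: sqr_eq0; rewrite -[RHS]e0 ?simp.
  by apply: (both0 al be) => //; rewrite -[RHS]e be0 ?simp.
- move=> _ al be l1 l2 nz; rewrite !(row3Z, row3D) !simp.
  apply: rank_normal_ge2 => // -[e be0 _ _]; apply: (both0 al be) => //.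
  by apply: sqr_eq0; rewrite -[RHS]e ?simp.
- move=> _ al be l1 l2 nz; rewrite !(row3Z, row3D) !simp.
  apply: rank_normal_ge2 => // -[_ be0 e _]; apply: (both0 al be) => //.
  by rewrite -[RHS]e be0 ?simp.
Qed.

End LabelRanks.

(* Reading the lists off the ranks *)
Local Close Scope group_scope.

Theorem theorem5p2
  (gT : finGroupType) (G : {group gT}) (p m1 m2 m3 : nat)
  (eta : 'F_p) (l : label p)
  (p_prime : prime p)
  (eta_nonresidue : odd p -> eta != 0%R /\ ~~ nonzero_square eta)
  (pG : (p.-group G)%g)
  (dG : ('m(G))%g = 3)
  (PhiG : ('Phi(G) \subset 'Z(G))%g)
  (abelemG' : (p.-abelem G^`(1))%g)
  (cardG' : #|(G^`(1))%g| = p ^ 3)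
  (typeG : abelian_type (G / G^`(1))%g = [:: p ^ m1; p ^ m2; p ^ m3])
  (m12 : m1 = m2) (m23 : m2 > m3) (m3_ge1 : m3 >= 1)
  (l_listed : admissible eta l)
  (G_char : char_matrix m1 m2 m3 G (label_mx l)) :
  [/\ (is_Imin p G m3 ->
       match l with
       | G1 | G2 _ | G3 _ | G4 _ | G5 | G6 | G7 | G8 _ | G9
       | H1 | H2 | H3 _ | H4 _ | H5 | H6 | H7 | H12 | H13 => True
       | _ => False
       end),
      (is_Imin p G (m3 + 1) ->
       match l with
       | H8 | H9 _ | H10 | H11 | H14 | H15 _ | I2 | I3 | I6 => True
       | _ => False
       end)
    & (is_Imin p G (m3 + 2) ->
       match l with
       | I1 | I4 | I5 => True
       | _ => False
       end)] /\
  [/\ (is_Imax p G (m1 + 2) ->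
       match l with
       | H1 | H2 => True
       | H3 nu => nonzero_square (- nu)%R
       | H4 r => nonzero_square (- r%:R : 'F_p)%R
       | H5 | H6 | H10 | H13 | H15 _ | I2 | I3 | I4 | I5 | I6 => True
       | _ => False
       end),
      (is_Imax p G (m1 + 1) ->
       match l with
       | G1 | G2 _ => True
       | G3 nu => nonzero_square (- nu)%R
       | G4 r => nonzero_square (- r%:R : 'F_p)%R
       | G5 | G6 | G8 _ | G9 => True
       | H3 nu => ~~ nonzero_square (- nu)%R
       | H4 r => ~~ nonzero_square (- r%:R : 'F_p)%R
       | H7 | H8 | H9 _ | H11 | H12 | H14 | I1 => True
       | _ => False
       end)
    & (is_Imax p G m1 ->
       match l with
       | G3 nu => ~~ nonzero_square (- nu)%R
       | G4 r => ~~ nonzero_square (- r%:R : 'F_p)%R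
       | G7 => True
       | _ => False
       end)].
Proof.
case: G_char => a1 [a2 [a3 [[Ga1 Ga2 Ga3] defQ [o1 o2 o3] /= [e1 e2 e3]]]].
(* In a p-group the Frattini subgroup is generated by [G'] and the p-th powers. *)
have sDZ : (G^`(1))%G \subset 'Z(G)%g.
  by apply: subset_trans PhiG; rewrite (Phi_joing pG) joing_subl.
have nDG : G \subset 'N(G^`(1))%g := der_norm 1 G.
have oG : #|G| = (p ^ (2 * m1 + m3 + 3))%N.
  rewrite -(Lagrange (der_sub 1 G)) cardG' -card_quotient // mulnC expnD.
  have [[B _ defB _] _ _ _] := dprodP defQ; rewrite defB in defQ.
  rewrite -(dprod_card defQ) -(dprod_card defB) -!orderE o1 o2 o3 -m12.
  by rewrite mul2n -addnn !expnD.
have genG : G \subset (<[a1]> * <[a2]> * <[a3]> * (G^`(1))%G)%g.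
  have [[B _ defB _] _ _ _] := dprodP defQ; rewrite defB in defQ.
  apply/subsetP=> g Gg; have := mem_quotient (G^`(1))%G Gg.
  rewrite -(dprodW defQ) -(dprodW defB).
  case/mulsgP=> u v /mulsgP[u1 u2 /cycleP[i ->] /cycleP[j ->] ->] /cycleP[k ->] eg.
  pose r := (a1 ^+ i * a2 ^+ j * a3 ^+ k)%g.
  have Gr : r \in G by rewrite !groupM ?groupX.
  have /rcosetP[c Dc eg'] : g \in ((G^`(1))%G :* r)%g.
    apply/rcoset_kercosetP; rewrite ?(subsetP nDG) // eg.
    by rewrite /r !morphM ?morphX ?(subsetP nDG) ?groupM ?groupX.
  have /setIP[_ /centP cGc] := subsetP sDZ c Dc.
  by rewrite eg' cGc // !mem_mulg ?mem_cycle.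
have ew s a : (a = [~ a2, a3] ^+ label_mx l (inord s) (inord 0)
    * [~ a3, a1] ^+ label_mx l (inord s) (inord 1)
    * [~ a1, a2] ^+ label_mx l (inord s) (inord 2) ->
    a = vecD a1 a2 a3 (row (inord s) (label_mx l)))%g.
  by move=> ->; rewrite /vecD !mxE.
have [f1 f2 f3] := And3 (ew 0 _ e1) (ew 1 _ e2) (ew 2 _ e3).
rewrite -m12 in m23 f2 o2.
have min_rk := is_Imin_rank p_prime pG sDZ abelemG' cardG' m3_ge1 m23 Ga1 Ga2 Ga3
                            f1 f2 f3 genG PhiG oG.
have max_le := is_Imax_le p_prime pG sDZ abelemG' cardG' m3_ge1 m23 Ga1 Ga2 Ga3
                          f1 f2 f3 genG.
have max_ge := is_Imax_ge p_prime pG sDZ abelemG' cardG' m3_ge1 m23 Ga1 Ga2 Ga3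
                          f1 f2 f3 genG PhiG oG.
have rows := label_rowsE l.
have Imin k : is_Imin p G k -> (k + rows12_rank l = m3 + 2)%N.
  move/min_rk.
  by rewrite -(rank_rows12 p_prime eta_nonresidue l_listed) rows.
have Imax k : is_Imax p G k -> (k + min_rank l = m1 + 3)%N.
  move=> max_k; apply/eqP; rewrite eqn_leq; apply/andP; split.
    apply: (max_le _ _ max_k).
    by have := rank_bound_label p_prime eta_nonresidue l_listed; rewrite rows.
  have [al [be [nz]]] := rank_label_le p_prime l_listed; rewrite rows => le_rank.
  apply: leq_trans (max_ge _ _ _ max_k nz) _.
  by rewrite leq_add2l.
(* The label now determines both invariants, and each list consists of the labels with the matching
   rank. *)
clear -Imin Imax; split.
  split=> /Imin; case: l {Imin Imax} => //= *; lia.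
split=> /Imax; case: l {Imin Imax} => //=.
all: try by move=> *; lia.
all: by move=> c; case: ifP => // _ *; lia.
Qed.
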